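(* Let $\lambda,a,t\in\mathbb{C}$ with $|\lambda|\le 1$, $\lambda\ne 1$, $\operatorname{Re} a>0$, $|t|<\operatorname{Re} a$, and let $p\ge 1$ be an integer. Then $$\sum_{n=0}^{\infty}\Phi(\lambda,n+1,a)\,\frac{t^{n+p}}{n+p}=\sum_{k=0}^{p-1}\binom{p-1}{k}\bigl[\Phi'_s(\lambda,-k,a-t)+\psi(k+1)\,\Phi(\lambda,-k,a-t)\bigr]\,t^{p-1-k}-\bigl[\Phi'_s(\lambda,1-p,a)+\psi(p)\,\Phi(\lambda,1-p,a)\bigr].$$
   Context: $\Phi(\lambda,s,a)$ is the Lerch transcendent: for $\operatorname{Re} a>0$, $\operatorname{Re} s>0$, $|\lambda|\le 1$, $\lambda\neq 1$, $$\Phi(\lambda,s,a)=\sum_{n=0}^\infty\frac{\lambda^n}{(n+a)^s}$$ (principal powers, $\lambda^0=1$), and for other $s\in\mathbb{C}$ it is defined by analytic continuation in $s$ (for $|\lambda|<1$ the series itself converges for all $s$). $\Phi'_s(\lambda,s,a)=\partial_s\Phi(\lambda,s,a)$. $\psi=\Gamma'/\Gamma$ is the digamma function. The convention $t^0=1$ (also for $t=0$) is used. *)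

(* Defs.v *)
From Stdlib Require Import Reals ClassicalEpsilon.
From Coquelicot Require Import Coquelicot.

Open Scope C_scope.

(* Principal argument, in (-PI, PI], of a nonzero z. *)
Definition Carg (z : C) : R :=
  if Rle_dec 0 (Im z) then acos (Re z / Cmod z) else (- acos (Re z / Cmod z))%R.

Definition Clog (z : C) : C := (ln (Cmod z), Carg z).

Definition Cexp (z : C) : C :=
  (exp (Re z) * cos (Im z), exp (Re z) * sin (Im z))%R.

(* Principal power z ^ w, meaningful for z <> 0. *)
Definition Cpower (z w : C) : C := Cexp (w * Clog z).

Definition Cseries (u : nat -> C) (l : C) : Prop :=
  @is_series C_AbsRing C_NormedModule u l.

(* Analytic on all of C: near every point, the sum of a power series. *)
Definition analytic (F : C -> C) : Prop :=
  forall s0 : C, exists (c : nat -> C) (r : R), (0 < r)%R /\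
    forall s : C, (Cmod (s - s0) < r)%R ->
      Cseries (fun n => c n * (s - s0) ^ n) (F s).

Definition lerch_continuation (lambda a : C) (F : C -> C) : Prop :=
  analytic F /\
  forall s : C, (0 < Re s)%R ->
    Cseries (fun n => lambda ^ n / Cpower (RtoC (INR n) + a) s) (F s).

(* Lerch transcendent.  For Re a > 0, |lambda| <= 1 and lambda <> 1 there is
   exactly one continuation; elsewhere the value is irrelevant. *)
Definition Phi (lambda s a : C) : C :=
  epsilon (inhabits (fun _ : C => RtoC 0)) (lerch_continuation lambda a) s.

(* C_derive is the complex derivative of a complex-differentiable function
   (C_derive_correct), hence of the analytic function s |-> Phi lambda s a. *)
Definition dPhi (lambda s a : C) : C :=
  C_derive (fun z => Phi lambda z a) s.

(* Euler's integral: Gamma on the positive reals. *)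
Definition Gamma (x : R) : R :=
  RInt_gen (fun u => (Rpower u (x - 1) * exp (- u))%R)
    (at_right 0) (Rbar_locally p_infty).

Definition digamma (x : R) : R := (Derive Gamma x / Gamma x)%R.

(* Main.v *)
Require Import Defs.
From Stdlib Require Import Reals Lra Lia Factorial ClassicalEpsilon.
From Coquelicot Require Import Coquelicot.
Open Scope C_scope.

(** Put x = m + a.  Since lambda <> 1, Abel summation turns [sum lambda^m f m]
    into [(f 0 + lambda * sum lambda^m (f (m+1) - f m)) / (1 - lambda)]; after K
    steps it converges absolutely for [f m = x^(-s)] as soon as Re s + K > 1, and
    so does the sum of every Taylor coefficient of x^(-s) in s.  This yields the
    analytic continuation of Phi in s, and exhibits Phi(lambda,s,a) and
    Phi'_s(lambda,s,a) as the regularized sums, over the same m and with the same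
    K, of x^(-s) and of - log x * x^(-s).  Regularized summation is linear, so the
    identity only has to hold for each m.  There it reads
    [sum_n t^(n+p) / (x^(n+1) (n+p))
       = x^(p-1) (log x - log (x-t) - sum_(0<j<p) (t/x)^j / j)],
    which is the logarithmic series; the digamma terms account for the subtracted
    polynomial through [psi(k+1) = psi(1) + 1 + ... + 1/k] and Pascal's rule. *)

(** * Convergent complex series *)

(** What shapes the proof is uniformity. The factors |log x|^j / j! in the Taylor coefficients of
    x^(-s) are all at most e^|log x|, which costs one power of |x| and serves every j at once.
    Asking for the summable majorant (m + Re a)^(-2) then turns the condition on K into Re s + K >=
    3, and into Re s + K >= 4 where s moves in a unit disc with K fixed. Both interchanges of
    summation, with the Taylor series in s and with the series in n, use one criterion: a majorant
    of product form in the two indices for the K-th differences. The condition |t| < Re a supplies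
    the ratio |t| / Re a of the majorant in n, and it keeps every x - t in the right half-plane,
    away from the branch cut. [Phi] is a choice among continuations, hence their uniqueness is
    proved as well. The digamma function is that of Euler's integral, so Gamma(x + 1) = x Gamma(x)
    has to be differentiated; this is done along one sequence of steps tending to 0, where convexity
    of Gamma provides the limit. *)

Definition Csum (u : nat -> C) (n : nat) : C := sum_n (G := C_AbelianMonoid) u n.

Lemma Csum_0 (u : nat -> C) : Csum u 0 = u 0%nat.
Proof. apply (sum_O (G := C_AbelianMonoid)). Qed.

Lemma Csum_S (u : nat -> C) (n : nat) : Csum u (S n) = Csum u n + u (S n).
Proof. apply (sum_Sn (G := C_AbelianMonoid)). Qed.

Lemma Csum_ext (u v : nat -> C) (n : nat) :
  (forall k, (k <= n)%nat -> u k = v k) -> Csum u n = Csum v n.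
Proof. apply (sum_n_ext_loc (G := C_AbelianMonoid)). Qed.

Lemma Csum_plus (u v : nat -> C) (n : nat) :
  Csum (fun k => u k + v k) n = Csum u n + Csum v n.
Proof. apply (sum_n_plus (G := C_AbelianMonoid)). Qed.

Lemma Csum_scal (c : C) (u : nat -> C) (n : nat) :
  Csum (fun k => c * u k) n = c * Csum u n.
Proof. apply (sum_n_mult_l (K := C_Ring)). Qed.

Lemma Csum_shift (u : nat -> C) (n : nat) :
  Csum u (S n) = u 0%nat + Csum (fun k => u (S k)) n.
Proof.
  induction n as [|n IH].
  - now rewrite Csum_S, !Csum_0.
  - rewrite Csum_S, IH, (Csum_S (fun k => u (S k))). ring.
Qed.

(** Stated through a real sequence, so that squeezing and limit arithmetic over the reals apply;
    [Clim_filterlim] ties it to the filter behind [Cseries]. *)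
Definition Clim (u : nat -> C) (l : C) : Prop :=
  is_lim_seq (fun n => Cmod (u n - l)) 0.

Lemma Clim_le (u : nat -> C) (l : C) (e : nat -> R) :
  (forall n, (Cmod (u n - l) <= e n)%R) -> is_lim_seq e 0 -> Clim u l.
Proof.
  intros H He.
  apply is_lim_seq_le_le with (u := fun _ => 0%R) (w := e);
    [|apply is_lim_seq_const | exact He].
  intros n; split; [apply Cmod_ge_0 | apply H].
Qed.

Lemma Clim_filterlim (u : nat -> C) (l : C) :
  Clim u l <->
  filterlim u eventually (@locally (NormedModule.UniformSpace C_AbsRing C_NormedModule) l).
Proof.
  unfold Clim. rewrite <- is_lim_seq_spec. split.
  - intros H.
    apply (filterlim_locally_ball_norm (K := C_AbsRing) (U := C_NormedModule) u l).
    intros eps. destruct (H eps) as [N HN]. exists N; intros n Hn.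
    specialize (HN n Hn). unfold ball_norm.
    change (Cmod (u n - l) < eps)%R.
    rewrite Rminus_0_r, Rabs_pos_eq in HN; [exact HN | apply Cmod_ge_0].
  - intros H eps.
    destruct (proj1 (filterlim_locally_ball_norm (K := C_AbsRing) (U := C_NormedModule) u l) H eps)
      as [N HN].
    exists N; intros n Hn. specialize (HN n Hn).
    rewrite Rminus_0_r, Rabs_pos_eq; [exact HN | apply Cmod_ge_0].
Qed.

Lemma Cseries_Clim (u : nat -> C) (l : C) : Cseries u l <-> Clim (Csum u) l.
Proof. symmetry. apply Clim_filterlim. Qed.

Lemma Clim_unique (u : nat -> C) (l l' : C) : Clim u l -> Clim u l' -> l = l'.
Proof.
  intros H H'. apply Ceq_minus, Cmod_eq_0, Rle_antisym; [|apply Cmod_ge_0].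
  apply (is_lim_seq_le (fun _ => Cmod (l - l')) _ (Cmod (l - l')) 0)
    with (2 := is_lim_seq_const _)
         (3 := eq_ind _ (is_lim_seq _) (is_lim_seq_plus' _ _ _ _ H H') _
               (f_equal Finite (Rplus_0_l 0))).
  intros n. rewrite <- (Cmod_opp (u n - l)).
  replace (l - l') with (- (u n - l) + (u n - l')) by ring.
  apply Cmod_triangle.
Qed.

Lemma Clim_ext (u v : nat -> C) (l : C) :
  (forall n, u n = v n) -> Clim u l -> Clim v l.
Proof. intros H; apply is_lim_seq_ext; intros n; now rewrite H. Qed.

Lemma Clim_plus (u v : nat -> C) (l l' : C) :
  Clim u l -> Clim v l' -> Clim (fun n => u n + v n) (l + l').
Proof.
  intros H H'. eapply Clim_le.
  2: { replace (Finite 0) with (Finite (0 + 0)) by (f_equal; ring).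
       apply is_lim_seq_plus'; [exact H | exact H']. }
  intros n. cbv beta. replace (u n + v n - (l + l')) with ((u n - l) + (v n - l')) by ring.
  apply Cmod_triangle.
Qed.

Lemma Clim_const (c : C) : Clim (fun _ => c) c.
Proof.
  apply Clim_le with (e := fun _ => 0%R); [|apply is_lim_seq_const].
  intros n. replace (c - c) with (RtoC 0) by ring. rewrite Cmod_0. lra.
Qed.

Lemma Clim_scal (c : C) (u : nat -> C) (l : C) :
  Clim u l -> Clim (fun n => c * u n) (c * l).
Proof.
  intros H. eapply Clim_le.
  2: { replace (Finite 0) with (Rbar_mult (Cmod c) 0) by (simpl; f_equal; ring).
       apply is_lim_seq_scal_l; exact H. }
  intros n. cbv beta. replace (c * u n - c * l) with (c * (u n - l)) by ring.
  rewrite Cmod_mult. lra.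
Qed.

Lemma Clim_incr (u : nat -> C) (l : C) : Clim (fun n => u (S n)) l <-> Clim u l.
Proof. symmetry. apply (is_lim_seq_incr_1 (fun n => Cmod (u n - l))). Qed.

Lemma Cseries_unique (u : nat -> C) (l l' : C) : Cseries u l -> Cseries u l' -> l = l'.
Proof. rewrite !Cseries_Clim. apply Clim_unique. Qed.

Lemma Cseries_ext (u v : nat -> C) (l : C) :
  (forall n, u n = v n) -> Cseries u l -> Cseries v l.
Proof. apply (is_series_ext (V := C_NormedModule)). Qed.

Lemma Cseries_plus (u v : nat -> C) (l l' : C) :
  Cseries u l -> Cseries v l' -> Cseries (fun n => u n + v n) (l + l').
Proof. apply (is_series_plus (V := C_NormedModule)). Qed.

Lemma Cseries_scal (c : C) (u : nat -> C) (l : C) :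
  Cseries u l -> Cseries (fun n => c * u n) (c * l).
Proof. apply (is_series_scal (V := C_NormedModule)). Qed.

Lemma Cseries_minus (u v : nat -> C) (l l' : C) :
  Cseries u l -> Cseries v l' -> Cseries (fun n => u n - v n) (l - l').
Proof. apply (is_series_minus (V := C_NormedModule)). Qed.

Lemma Cseries_zero : Cseries (fun _ => RtoC 0) 0.
Proof.
  apply Cseries_Clim, Clim_ext with (u := fun _ => RtoC 0); [|apply Clim_const].
  intros n; induction n as [|n IH]; [now rewrite Csum_0|].
  rewrite Csum_S, <- IH. ring.
Qed.

Lemma Cseries_shift (u : nat -> C) (l : C) :
  Cseries (fun n => u (S n)) l <-> Cseries u (u 0%nat + l).
Proof.
  rewrite !Cseries_Clim, <- (Clim_incr (Csum u)). split; intros H.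
  - eapply Clim_ext; [|apply Clim_plus; [apply (Clim_const (u 0%nat)) | exact H]].
    intros n. cbv beta. now rewrite Csum_shift.
  - replace l with (- u 0%nat + (u 0%nat + l)) by ring.
    eapply Clim_ext; [|apply Clim_plus; [apply (Clim_const (- u 0%nat)) | exact H]].
    intros n. cbv beta. rewrite Csum_shift. ring.
Qed.

Lemma Cseries_term_lim (u : nat -> C) (l : C) : Cseries u l -> Clim u 0.
Proof.
  rewrite Cseries_Clim. intros H. apply Clim_incr.
  replace (RtoC 0) with (l + (- (1)) * l) by ring.
  eapply Clim_ext; [|apply Clim_plus;
    [apply Clim_incr, H | apply Clim_scal, H]].
  intros n. cbv beta. rewrite Csum_S. ring.
Qed.

Lemma Cseries_comp (u : nat -> C) (l : C) :
  Cseries u l <-> is_series (fun n => Re (u n)) (Re l) /\ is_series (fun n => Im (u n)) (Im l).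
Proof.
  rewrite Cseries_Clim.
  assert (HR : forall n, Re (Csum u n) = sum_n (fun k => Re (u k)) n).
  { induction n as [|n IH]; [now rewrite Csum_0, sum_O|].
    rewrite Csum_S, sum_Sn, <- IH. reflexivity. }
  assert (HI : forall n, Im (Csum u n) = sum_n (fun k => Im (u k)) n).
  { induction n as [|n IH]; [now rewrite Csum_0, sum_O|].
    rewrite Csum_S, sum_Sn, <- IH. reflexivity. }
  split.
  - intros H; split; apply (is_lim_seq_spec _ (Finite _)); intros eps;
      apply is_lim_seq_spec in H; destruct (H eps) as [N HN]; exists N; intros n Hn;
      specialize (HN n Hn); rewrite Rminus_0_r, Rabs_pos_eq in HN by apply Cmod_ge_0;
      eapply Rle_lt_trans; [|exact HN| |exact HN].
    + rewrite <- HR. eapply Rle_trans; [|apply re_le_Cmod]. right; reflexivity.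
    + rewrite <- HI. eapply Rle_trans; [|apply Rmax_Cmod].
      eapply Rle_trans; [|apply Rmax_r]. right; reflexivity.
  - intros [H1 H2].
    assert (H1' : is_lim_seq (fun n => Rabs (Re (Csum u n) - Re l)) 0).
    { rewrite <- Rabs_R0. apply is_lim_seq_abs with (l := Finite 0%R).
      replace (Finite 0) with (Finite (Re l - Re l)) by (f_equal; ring).
      apply is_lim_seq_minus'; [|apply is_lim_seq_const].
      eapply is_lim_seq_ext; [intros n; symmetry; apply HR | exact H1]. }
    assert (H2' : is_lim_seq (fun n => Rabs (Im (Csum u n) - Im l)) 0).
    { rewrite <- Rabs_R0. apply is_lim_seq_abs with (l := Finite 0%R).
      replace (Finite 0) with (Finite (Im l - Im l)) by (f_equal; ring).
      apply is_lim_seq_minus'; [|apply is_lim_seq_const].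
      eapply is_lim_seq_ext; [intros n; symmetry; apply HI | exact H2]. }
    eapply Clim_le.
    2: { replace (Finite 0) with (Finite (0 + 0)) by (f_equal; ring).
         apply is_lim_seq_plus'; [exact H1' | exact H2']. }
    intros n. cbv beta.
    set (z := Csum u n).
    replace (z - l) with (RtoC (Re z - Re l) + Ci * RtoC (Im z - Im l)).
    2:{ destruct z, l; unfold Ci, RtoC, Cmult, Cminus, Cplus, Copp; simpl. f_equal; ring. }
    eapply Rle_trans; [apply Cmod_triangle|].
    rewrite Cmod_mult, Cmod_Ci, !Cmod_R. lra.
Qed.

(** Beyond [N] the partial sums of [u] move by at most as much as those of [b], and this survives
    the passage to the limit. [Cseries_exchange] needs such an explicit tail. *)
Lemma Cseries_tail (u : nat -> C) (b : nat -> R) (l : C) (lb : R) (N : nat) :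
  (forall n, (Cmod (u n) <= b n)%R) -> is_series b lb -> Cseries u l ->
  (Cmod (l - Csum u N) <= lb - sum_n b N)%R.
Proof.
  intros Hb Hlb Hu. apply Cseries_Clim in Hu.
  assert (Hk : forall k, (Cmod (Csum u (k + N) - Csum u N) <= sum_n b (k + N) - sum_n b N)%R).
  { induction k as [|k IH].
    - simpl. replace (Csum u N - Csum u N) with (RtoC 0) by ring. rewrite Cmod_0. lra.
    - simpl. rewrite Csum_S, sum_Sn.
      replace (Csum u (k + N) + u (S (k + N)) - Csum u N) with
        ((Csum u (k + N) - Csum u N) + u (S (k + N))) by ring.
      eapply Rle_trans; [apply Cmod_triangle|].
      specialize (Hb (S (k + N))). change plus with Rplus. simpl in *. lra. }
  assert (H : Rbar_le (Cmod (l - Csum u N)) (0 + (lb - sum_n b N))%R).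
  { eapply is_lim_seq_le with
      (v := fun k => (Cmod (Csum u (k + N) - l) + (sum_n b (k + N) - sum_n b N))%R);
      [|apply is_lim_seq_const|].
    - intros k. replace (l - Csum u N) with
        (- (Csum u (k + N) - l) + (Csum u (k + N) - Csum u N)) by ring.
      eapply Rle_trans; [apply Cmod_triangle|]. rewrite Cmod_opp. specialize (Hk k). lra.
    - apply is_lim_seq_plus'.
      + apply (is_lim_seq_incr_n (fun k => Cmod (Csum u k - l))). exact Hu.
      + apply is_lim_seq_minus'; [|apply is_lim_seq_const].
        apply (is_lim_seq_incr_n (sum_n b)). exact Hlb. }
  simpl in H. lra.
Qed.

Lemma Cseries_le (u : nat -> C) (b : nat -> R) (l : C) (lb : R) :
  (forall n, (Cmod (u n) <= b n)%R) -> is_series b lb -> Cseries u l ->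
  (Cmod l <= lb)%R.
Proof.
  intros Hb Hlb Hu. pose proof (Cseries_tail u b l lb 0 Hb Hlb Hu) as H.
  rewrite Csum_0, sum_O in H. specialize (Hb 0%nat).
  replace l with ((l - u 0%nat) + u 0%nat) by ring.
  eapply Rle_trans; [apply Cmod_triangle|]. lra.
Qed.

Lemma Cseries_ex_le (u : nat -> C) (b : nat -> R) :
  (forall n, (Cmod (u n) <= b n)%R) -> ex_series b -> exists l, Cseries u l.
Proof. apply (ex_series_le (V := C_CompleteNormedModule)). Qed.

Lemma Cseries_bounded (u : nat -> C) (l : C) :
  Cseries u l -> exists M : R, forall n, (Cmod (u n) <= M)%R.
Proof.
  intros H. apply Cseries_term_lim in H.
  destruct (filterlim_bounded (fun n => Cmod (u n - 0))) as [M HM].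
  { exists 0%R. exact H. }
  exists M. intros n. specialize (HM n).
  change (Rabs (Cmod (u n - 0)) <= M)%R in HM.
  rewrite Rabs_pos_eq in HM by apply Cmod_ge_0.
  now replace (u n) with (u n - 0) by ring.
Qed.

Lemma Cseries_Csum (u : nat -> nat -> C) (l : nat -> C) (N : nat) :
  (forall k, (k <= N)%nat -> Cseries (u k) (l k)) ->
  Cseries (fun n => Csum (fun k => u k n) N) (Csum l N).
Proof.
  induction N as [|N IH]; intros H.
  - rewrite Csum_0. eapply Cseries_ext; [|apply H; lia]. intros n; now rewrite Csum_0.
  - rewrite Csum_S. eapply Cseries_ext.
    + intros n. symmetry. apply Csum_S.
    + apply Cseries_plus; [apply IH; intros k Hk; apply H; lia | apply H; lia].
Qed.

(** With a majorant of product form, every column cut after [N] misses at most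
    [(SB - sum_n B N) * w n]. Summing over [n] leaves [(SB - sum_n B N) * W], which tends to 0. *)
Lemma Cseries_exchange (u : nat -> nat -> C) (B w : nat -> R) (U l : nat -> C) :
  (forall m n, (Cmod (u m n) <= B m * w n)%R) ->
  ex_series B -> ex_series w ->
  (forall m, Cseries (u m) (U m)) ->
  (forall n, Cseries (fun m => u m n) (l n)) ->
  exists L, Cseries l L /\ Cseries U L.
Proof.
  intros Hu [SB HB] [W HW] HU Hl.
  assert (Hcol : forall n N, (Cmod (l n - Csum (fun m => u m n) N) <= (SB - sum_n B N) * w n)%R).
  { intros n N. eapply Rle_trans.
    - apply Cseries_tail with (b := fun m => (B m * w n)%R) (lb := (SB * w n)%R);
        [intros m; apply Hu | now apply is_series_scal_r | apply Hl].
    - right. rewrite Rmult_minus_distr_r. f_equal.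
      apply (sum_n_mult_r (K := R_Ring)). }
  destruct (Cseries_ex_le l (fun n => (SB * w n)%R)) as [L HL].
  { intros n. apply Cseries_le with (u := fun m => u m n) (b := fun m => (B m * w n)%R);
      [intros m; apply Hu | now apply is_series_scal_r | apply Hl]. }
  { apply (ex_series_scal_l SB w). now exists W. }
  exists L; split; [exact HL|].
  apply Cseries_Clim. eapply Clim_le with (e := fun N => ((SB - sum_n B N) * W)%R).
  - intros N. rewrite <- Cmod_opp. replace (- (Csum U N - L)) with (L - Csum U N) by ring.
    apply Cseries_le with (u := fun n => l n - Csum (fun m => u m n) N)
      (b := fun n => ((SB - sum_n B N) * w n)%R).
    + intros n; apply Hcol.
    + apply (is_series_scal_l (SB - sum_n B N)%R w W HW).
    + apply Cseries_minus; [exact HL | apply Cseries_Csum; intros k _; apply HU].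
  - replace (Finite 0) with (Rbar_mult (SB - SB)%R W) by (simpl; f_equal; ring).
    apply is_lim_seq_scal_r, is_lim_seq_minus'; [apply is_lim_seq_const | exact HB].
Qed.

(** * Iterated Abel summation *)

Definition fdiff (f : nat -> C) (m : nat) : C := f (S m) - f m.

(** The difference is applied innermost, in step with [abel_sum]; [fdiffs_S] recovers the outermost
    form used for bounds and limits. *)
Fixpoint fdiffs (K : nat) (f : nat -> C) : nat -> C :=
  match K with O => f | S K' => fdiffs K' (fdiff f) end.

(* Assigns a value to [sum lambda^m f m] as soon as the [K]-th differences of [f]
   are summable. *)
Fixpoint abel_sum (lambda : C) (K : nat) (f : nat -> C) (l : C) : Prop :=
  match K with
  | O => Cseries (fun m => lambda ^ m * f m) l
  | S K' => exists l', abel_sum lambda K' (fdiff f) l' /\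
                       l = (f 0%nat + lambda * l') / (1 - lambda)
  end.

Lemma fdiffs_ext (K : nat) (f g : nat -> C) :
  (forall m, f m = g m) -> forall m, fdiffs K f m = fdiffs K g m.
Proof.
  revert f g; induction K as [|K IH]; intros f g H; simpl; [exact H|].
  apply IH; intros m; unfold fdiff; now rewrite !H.
Qed.

Lemma fdiffs_S (K : nat) (f : nat -> C) (m : nat) :
  fdiffs (S K) f m = fdiffs K f (S m) - fdiffs K f m.
Proof.
  revert f; induction K as [|K IH]; intros f; [reflexivity|].
  change (fdiffs (S K) (fdiff f) m = fdiffs (S K) f (S m) - fdiffs (S K) f m).
  rewrite IH. reflexivity.
Qed.

Lemma fdiffs_scal (K : nat) (c : C) (f : nat -> C) (m : nat) :
  fdiffs K (fun m => c * f m) m = c * fdiffs K f m.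
Proof.
  revert m; induction K as [|K IH]; intros m; [reflexivity|].
  rewrite !fdiffs_S, !IH. ring.
Qed.

(** Each difference at most doubles a decreasing majorant. This crude estimate gains no decay, so it
    serves terms that are already summable, such as x^(-n-1) with n >= 1. *)
Lemma fdiffs_bound (K : nat) (f : nat -> C) (b : nat -> R) :
  (forall m, (b (S m) <= b m)%R) -> (forall m, (Cmod (f m) <= b m)%R) ->
  forall m, (Cmod (fdiffs K f m) <= 2 ^ K * b m)%R.
Proof.
  intros Hd Hb; induction K as [|K IH]; intros m.
  - simpl. specialize (Hb m). lra.
  - rewrite fdiffs_S. unfold Cminus.
    eapply Rle_trans; [apply Cmod_triangle|]. rewrite Cmod_opp.
    pose proof (IH m). pose proof (IH (S m)).
    assert (2 ^ K * b (S m) <= 2 ^ K * b m)%R.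
    { apply Rmult_le_compat_l; [apply pow_le; lra | apply Hd]. }
    simpl. lra.
Qed.

Lemma Clim_fdiffs (K : nat) (f : nat -> C) : Clim f 0 -> Clim (fdiffs K f) 0.
Proof.
  intros Hf; induction K as [|K IH]; [exact Hf|].
  eapply Clim_ext; [intros n; symmetry; apply fdiffs_S|].
  replace (RtoC 0) with (0 + (- (1)) * 0) by ring.
  eapply Clim_ext; [|apply Clim_plus; [apply Clim_incr, IH | apply Clim_scal, IH]].
  intros n. cbv beta. ring.
Qed.

Section AbelSum.
Context (lambda : C) (hlambda : (Cmod lambda <= 1)%R) (hlambda1 : lambda <> RtoC 1).

Lemma one_minus_neq_0 : 1 - lambda <> 0.
Proof. intros H. apply hlambda1. symmetry. now apply Ceq_minus. Qed.

Lemma Cmod_pow_mult_le (m : nat) (z : C) (b : R) :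
  (Cmod z <= b)%R -> (Cmod (lambda ^ m * z) <= b)%R.
Proof.
  intros H. rewrite Cmod_mult, Cmod_pow.
  assert (Cmod lambda ^ m <= 1)%R.
  { rewrite <- (pow1 m). apply pow_incr. split; [apply Cmod_ge_0 | exact hlambda]. }
  pose proof (Cmod_ge_0 z). pose proof (pow_le (Cmod lambda) m (Cmod_ge_0 _)). nra.
Qed.

Lemma abel_sum_unique (K : nat) (f : nat -> C) (l l' : C) :
  abel_sum lambda K f l -> abel_sum lambda K f l' -> l = l'.
Proof.
  revert f l l'; induction K as [|K IH]; intros f l l'; simpl.
  - apply Cseries_unique.
  - intros [a [Ha ->]] [b [Hb ->]]. now rewrite (IH _ _ _ Ha Hb).
Qed.

Lemma abel_sum_ext (K : nat) (f g : nat -> C) (l : C) :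
  (forall m, f m = g m) -> abel_sum lambda K f l -> abel_sum lambda K g l.
Proof.
  revert f g l; induction K as [|K IH]; intros f g l H; simpl.
  - apply Cseries_ext. intros m; now rewrite H.
  - intros [a [Ha ->]]. exists a; split; [|now rewrite H].
    revert Ha; apply IH. intros m; unfold fdiff; now rewrite !H.
Qed.

Lemma abel_sum_plus (K : nat) (f g : nat -> C) (l l' : C) :
  abel_sum lambda K f l -> abel_sum lambda K g l' ->
  abel_sum lambda K (fun m => f m + g m) (l + l').
Proof.
  revert f g l l'; induction K as [|K IH]; intros f g l l'; simpl.
  - intros H H'. eapply Cseries_ext; [|apply (Cseries_plus _ _ _ _ H H')].
    intros m; cbv beta; ring.
  - intros [a [Ha ->]] [b [Hb ->]]. exists (a + b); split.
    + eapply abel_sum_ext; [|apply (IH _ _ _ _ Ha Hb)].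
      intros m; unfold fdiff; ring.
    + field. apply one_minus_neq_0.
Qed.

Lemma abel_sum_scal (K : nat) (c : C) (f : nat -> C) (l : C) :
  abel_sum lambda K f l -> abel_sum lambda K (fun m => c * f m) (c * l).
Proof.
  revert f l; induction K as [|K IH]; intros f l; simpl.
  - intros H. eapply Cseries_ext; [|apply (Cseries_scal c _ _ H)].
    intros m; cbv beta; ring.
  - intros [a [Ha ->]]. exists (c * a); split.
    + eapply abel_sum_ext; [|apply (IH _ _ Ha)].
      intros m; unfold fdiff; ring.
    + field. apply one_minus_neq_0.
Qed.

Lemma abel_sum_Csum (K N : nat) (f : nat -> nat -> C) (l : nat -> C) :
  (forall k, (k <= N)%nat -> abel_sum lambda K (f k) (l k)) ->
  abel_sum lambda K (fun m => Csum (fun k => f k m) N) (Csum l N).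
Proof.
  induction N as [|N IH]; intros H.
  - rewrite Csum_0. eapply abel_sum_ext; [|apply H; lia]. intros n; now rewrite Csum_0.
  - rewrite Csum_S. eapply abel_sum_ext.
    + intros n. symmetry. apply Csum_S.
    + apply abel_sum_plus; [apply IH; intros k Hk; apply H; lia | apply H; lia].
Qed.

Lemma abel_sum_exists (K : nat) (f : nat -> C) (b : nat -> R) :
  (forall m, (Cmod (fdiffs K f m) <= b m)%R) -> ex_series b ->
  exists l, abel_sum lambda K f l.
Proof.
  revert f; induction K as [|K IH]; intros f Hb Hex.
  - apply Cseries_ex_le with b; [|exact Hex].
    intros m. apply Cmod_pow_mult_le, Hb.
  - destruct (IH (fdiff f) Hb Hex) as [l Hl].
    exists ((f 0%nat + lambda * l) / (1 - lambda)), l. now split.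
Qed.

(** Summation by parts for partial sums; the last term is the boundary contribution that has to
    vanish in the limit. *)
Lemma abel_step_sum (f : nat -> C) (n : nat) :
  (1 - lambda) * Csum (fun m => lambda ^ m * f m) n =
  f 0%nat + lambda * Csum (fun m => lambda ^ m * fdiff f m) n - lambda ^ S n * f (S n).
Proof.
  induction n as [|n IH].
  - rewrite !Csum_0. unfold fdiff. simpl. ring.
  - rewrite !Csum_S. rewrite Cmult_plus_distr_l, IH. unfold fdiff. simpl. ring.
Qed.

(** Only the innermost step distinguishes the orders [S K] and [K]: there the boundary term of
    [abel_step_sum] vanishes because the [K]-th differences tend to 0. The outer steps are the same
    affine map. *)
Lemma abel_sum_down (K : nat) (f : nat -> C) (l : C) :
  Clim (fdiffs K f) 0 -> abel_sum lambda (S K) f l -> abel_sum lambda K f l.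
Proof.
  revert f l; induction K as [|K IH]; intros f l Hf [a [Ha ->]].
  - simpl in *. apply Cseries_Clim. apply Cseries_Clim in Ha.
    replace ((f 0%nat + lambda * a) / (1 - lambda)) with
      (/ (1 - lambda) * ((f 0%nat + lambda * a) + (- (1)) * 0))
      by (field; apply one_minus_neq_0).
    apply Clim_ext with (u := fun n => / (1 - lambda) *
      ((f 0%nat + lambda * Csum (fun m => lambda ^ m * fdiff f m) n)
        + (- (1)) * (lambda ^ S n * f (S n)))).
    { intros n.
      transitivity (/ (1 - lambda) * ((1 - lambda) * Csum (fun m => lambda ^ m * f m) n)).
      - rewrite abel_step_sum. ring.
      - field. apply one_minus_neq_0. }
    apply Clim_scal, Clim_plus.
    + apply Clim_plus; [apply Clim_const | now apply Clim_scal].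
    + apply Clim_scal. apply (Clim_incr (fun n => lambda ^ n * f n)).
      eapply Clim_le; [|exact Hf]. intros n. cbv beta.
      replace (lambda ^ n * f n - 0) with (lambda ^ n * (f n - 0)) by ring.
      apply Cmod_pow_mult_le. lra.
  - exists a; split; [|reflexivity]. apply IH; assumption.
Qed.

Lemma abel_sum_Cseries (K : nat) (f : nat -> C) (l : C) :
  Clim f 0 -> abel_sum lambda K f l -> Cseries (fun m => lambda ^ m * f m) l.
Proof.
  induction K as [|K IH]; intros Hf H; [exact H|].
  apply IH; [exact Hf|]. apply abel_sum_down; [|exact H]. now apply Clim_fdiffs.
Qed.

(** The bound provides some sum of order [S K]; [abel_sum_down] and uniqueness then force its value
    to be [l]. *)
Lemma abel_sum_up (K : nat) (f : nat -> C) (b : nat -> R) (l : C) :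
  (forall m, (Cmod (fdiffs K f m) <= b m)%R) -> ex_series b ->
  abel_sum lambda K f l -> abel_sum lambda (S K) f l.
Proof.
  intros Hb Hex Hl.
  destruct (abel_sum_exists (S K) f (fun m => (b (S m) + b m)%R)) as [l' Hl'].
  - intros m. rewrite fdiffs_S. unfold Cminus.
    eapply Rle_trans; [apply Cmod_triangle|]. rewrite Cmod_opp.
    apply Rplus_le_compat; apply Hb.
  - apply (ex_series_plus (V := R_NormedModule)); [|exact Hex].
    apply (proj1 (ex_series_incr_1 (V := R_NormedModule) b)), Hex.
  - replace l with l'; [exact Hl'|].
    apply (abel_sum_unique K f); [|exact Hl].
    apply abel_sum_down; [|exact Hl'].
    eapply Clim_le; [|apply ex_series_lim_0, Hex].
    intros n. replace (fdiffs K f n - 0) with (fdiffs K f n) by ring. apply Hb.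
Qed.

(** Each Abel step is affine in [f 0] and in the sum of the differences, so it commutes with a
    convergent series in [n]. Unrolling [K] steps leaves an interchange for the [K]-th differences,
    where the product bound applies. *)
Lemma abel_sum_exchange (K : nat) (f : nat -> nat -> C) (B w : nat -> R)
    (F : nat -> C) (l : nat -> C) :
  (forall n m, (Cmod (fdiffs K (f n) m) <= B m * w n)%R) ->
  ex_series B -> ex_series w ->
  (forall m, Cseries (fun n => f n m) (F m)) ->
  (forall n, abel_sum lambda K (f n) (l n)) ->
  exists L, Cseries l L /\ abel_sum lambda K F L.
Proof.
  intros H HB Hw. revert f F l H; induction K as [|K IH]; intros f F l H HF Hl.
  - destruct (Cseries_exchange (fun m n => lambda ^ m * f n m) B w
      (fun m => lambda ^ m * F m) l) as [L [HL HL']]; try assumption.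
    + intros m n. apply Cmod_pow_mult_le, H.
    + intros m. apply Cseries_scal, HF.
    + now exists L.
  - assert (Hl' : forall n, exists a, abel_sum lambda K (fdiff (f n)) a /\
                l n = (f n 0%nat + lambda * a) / (1 - lambda)) by exact Hl.
    (* [abel_sum] only asserts that an inner sum exists for each [n]; a whole sequence of them has
       to be chosen before the induction hypothesis can be used. *)
    set (l' := fun n => proj1_sig (constructive_indefinite_description _ (Hl' n))).
    assert (Hl1 : forall n, abel_sum lambda K (fdiff (f n)) (l' n) /\
                l n = (f n 0%nat + lambda * l' n) / (1 - lambda)).
    { intros n. apply (proj2_sig (constructive_indefinite_description _ (Hl' n))). }
    destruct (IH (fun n => fdiff (f n)) (fdiff F) l') as [L [HL HL']].
    + exact H.
    + intros m. unfold fdiff. apply Cseries_minus; apply HF.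
    + intros n; apply Hl1.
    + exists (/ (1 - lambda) * (F 0%nat + lambda * L)); split.
      * eapply Cseries_ext; [|apply Cseries_scal, Cseries_plus;
          [apply HF | apply Cseries_scal, HL]].
        intros n. cbv beta. rewrite (proj2 (Hl1 n)). unfold Cdiv. ring.
      * exists L; split; [exact HL' | unfold Cdiv; ring].
Qed.

End AbelSum.

(** * Complex-valued functions of a real variable *)

Lemma C_ext (z w : C) : Re z = Re w -> Im z = Im w -> z = w.
Proof. destruct z, w; simpl; intros -> ->; reflexivity. Qed.

(** Componentwise, so that the real derivative rules and the real mean value theorem apply along a
    real parameter. *)
Definition Cderiv (h : R -> C) (x : R) (d : C) : Prop :=
  is_derive (fun y => Re (h y)) x (Re d) /\ is_derive (fun y => Im (h y)) x (Im d).

Lemma Cderiv_ext (h k : R -> C) (x : R) (d : C) :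
  (forall y, h y = k y) -> Cderiv h x d -> Cderiv k x d.
Proof.
  intros H [H1 H2]; split;
    [apply (is_derive_ext (fun y => Re (h y))); [|exact H1]
    | apply (is_derive_ext (fun y => Im (h y))); [|exact H2]];
    intros y; now rewrite H.
Qed.

Lemma Cderiv_const (c : C) (x : R) : Cderiv (fun _ => c) x 0.
Proof. split; apply (is_derive_const (V := R_NormedModule)). Qed.

Lemma Cderiv_affine (z w : C) (x : R) : Cderiv (fun y => z + RtoC y * w) x w.
Proof.
  destruct z as [z1 z2], w as [w1 w2]; split; simpl; auto_derive; auto; ring.
Qed.

Lemma Cderiv_plus (h k : R -> C) (x : R) (d e : C) :
  Cderiv h x d -> Cderiv k x e -> Cderiv (fun y => h y + k y) x (d + e).
Proof.
  intros [H1 H2] [K1 K2]; split;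
    [exact (is_derive_plus _ _ _ _ _ H1 K1) | exact (is_derive_plus _ _ _ _ _ H2 K2)].
Qed.

Lemma is_derive_Rmult (f g : R -> R) (x a b : R) :
  is_derive f x a -> is_derive g x b ->
  is_derive (fun y => f y * g y)%R x (a * g x + f x * b)%R.
Proof. intros H K. apply (is_derive_mult f g x a b H K). intros; apply Rmult_comm. Qed.

Lemma Cderiv_mult (h k : R -> C) (x : R) (d e : C) :
  Cderiv h x d -> Cderiv k x e -> Cderiv (fun y => h y * k y) x (d * k x + h x * e).
Proof.
  intros [H1 H2] [K1 K2]; split.
  - evar_last;
      [exact (is_derive_minus _ _ _ _ _ (is_derive_Rmult _ _ _ _ _ H1 K1)
                                        (is_derive_Rmult _ _ _ _ _ H2 K2))|].
    unfold minus, plus, opp; simpl. unfold Re, Im; simpl. ring.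
  - evar_last;
      [exact (is_derive_plus _ _ _ _ _ (is_derive_Rmult _ _ _ _ _ H1 K2)
                                        (is_derive_Rmult _ _ _ _ _ H2 K1))|].
    unfold plus; simpl. unfold Re, Im; simpl. ring.
Qed.

Lemma Cderiv_scal (c : C) (h : R -> C) (x : R) (d : C) :
  Cderiv h x d -> Cderiv (fun y => c * h y) x (c * d).
Proof.
  intros H. replace (c * d) with (0 * h x + c * d) by ring.
  apply (Cderiv_mult (fun _ => c) h x 0 d (Cderiv_const c x) H).
Qed.

Lemma Cderiv_pow (h : R -> C) (x : R) (d : C) (n : nat) :
  Cderiv h x d -> Cderiv (fun y => h y ^ S n) x (RtoC (INR (S n)) * h x ^ n * d).
Proof.
  intros H; induction n as [|n IH].
  - apply (Cderiv_ext h); [intros y; simpl; ring|].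
    replace (RtoC (INR 1) * h x ^ 0 * d) with d by (simpl; ring). exact H.
  - change (Cderiv (fun y => h y * h y ^ S n) x (RtoC (INR (S (S n))) * h x ^ S n * d)).
    replace (RtoC (INR (S (S n))) * h x ^ S n * d) with
      (d * h x ^ S n + h x * (RtoC (INR (S n)) * h x ^ n * d)).
    + apply (Cderiv_mult h (fun y => h y ^ S n)); assumption.
    + rewrite (S_INR (S n)), RtoC_plus. simpl Cpow. ring.
Qed.

Lemma Cderiv_Csum (h d : nat -> R -> C) (x : R) (n : nat) :
  (forall k, (k <= n)%nat -> Cderiv (h k) x (d k x)) ->
  Cderiv (fun y => Csum (fun k => h k y) n) x (Csum (fun k => d k x) n).
Proof.
  induction n as [|n IH]; intros H.
  - rewrite Csum_0. apply (Cderiv_ext (h 0%nat)); [intros y; now rewrite Csum_0|].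
    apply H; lia.
  - rewrite Csum_S. eapply Cderiv_ext; [intros y; symmetry; apply Csum_S|].
    apply Cderiv_plus; [apply IH; intros k Hk; apply H; lia | apply H; lia].
Qed.

(** * The complex exponential *)

Lemma Cexp_plus (z w : C) : Cexp (z + w) = Cexp z * Cexp w.
Proof.
  unfold Cexp. apply C_ext; unfold Cmult; simpl;
    unfold Re, Im; rewrite exp_plus, ?cos_plus, ?sin_plus; ring.
Qed.

Lemma Cexp_0 : Cexp 0 = 1.
Proof.
  unfold Cexp. simpl. rewrite exp_0, cos_0, sin_0. unfold RtoC; f_equal; ring.
Qed.

Lemma Cmod_Cexp (z : C) : Cmod (Cexp z) = exp (Re z).
Proof.
  unfold Cmod, Cexp. simpl fst. simpl snd.
  replace ((exp (Re z) * cos (Im z)) ^ 2 + (exp (Re z) * sin (Im z)) ^ 2)%R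
    with (exp (Re z) ^ 2 * (Rsqr (sin (Im z)) + Rsqr (cos (Im z))))%R
    by (unfold Rsqr; ring).
  rewrite sin2_cos2, Rmult_1_r. apply sqrt_pow2. left; apply exp_pos.
Qed.

Lemma Cexp_neq_0 (z : C) : Cexp z <> 0.
Proof. apply Cmod_gt_0. rewrite Cmod_Cexp. apply exp_pos. Qed.

Lemma Cexp_opp (z : C) : Cexp (- z) = / Cexp z.
Proof.
  assert (H : Cexp (- z) * Cexp z = 1).
  { rewrite <- Cexp_plus, <- Cexp_0. f_equal. ring. }
  rewrite <- (Cmult_1_r (Cexp (- z))), <- (Cinv_r (Cexp z)) by apply Cexp_neq_0.
  rewrite Cmult_assoc, H. ring.
Qed.

Lemma Cexp_INR (n : nat) (z : C) : Cexp (RtoC (INR n) * z) = Cexp z ^ n.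
Proof.
  induction n as [|n IH].
  - simpl. rewrite <- Cexp_0. f_equal. ring.
  - rewrite S_INR, RtoC_plus.
    replace ((RtoC (INR n) + 1) * z) with (z + RtoC (INR n) * z) by ring.
    now rewrite Cexp_plus, IH.
Qed.

Lemma Cderiv_Cexp (h : R -> C) (x : R) (d : C) :
  Cderiv h x d -> Cderiv (fun y => Cexp (h y)) x (d * Cexp (h x)).
Proof.
  intros [H1 H2].
  assert (He : is_derive (fun y => exp (Re (h y))) x (Re d * exp (Re (h x)))%R).
  { apply (is_derive_comp exp (fun y => Re (h y))); [apply is_derive_exp | exact H1]. }
  assert (Hc : is_derive (fun y => cos (Im (h y))) x (Im d * - sin (Im (h x)))%R).
  { apply (is_derive_comp cos (fun y => Im (h y))); [apply is_derive_cos | exact H2]. }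
  assert (Hs : is_derive (fun y => sin (Im (h y))) x (Im d * cos (Im (h x)))%R).
  { apply (is_derive_comp sin (fun y => Im (h y))); [apply is_derive_sin | exact H2]. }
  split.
  - evar_last; [exact (is_derive_Rmult _ _ _ _ _ He Hc)|].
    unfold Cexp, Re, Im; simpl. ring.
  - evar_last; [exact (is_derive_Rmult _ _ _ _ _ He Hs)|].
    unfold Cexp, Re, Im; simpl. ring.
Qed.

(** The real mean value theorem is applied to the real and imaginary parts separately, at possibly
    different points; this is the origin of the factor 2. *)
Lemma Cderiv_mean_value (h d : R -> C) (a b D : R) :
  (a <= b)%R ->
  (forall y, (a <= y <= b)%R -> Cderiv h y (d y) /\ (Cmod (d y) <= D)%R) ->
  (Cmod (h b - h a) <= 2 * D * (b - a))%R.
Proof.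
  intros Hab H.
  assert (Hr : (Rabs (Re (h b) - Re (h a)) <= D * (b - a))%R).
  { destruct (MVT_gen (fun y => Re (h y)) a b (fun y => Re (d y))) as [c [Hc ->]].
    - intros y Hy. rewrite Rmin_left, Rmax_right in Hy by lra. apply H; lra.
    - intros y Hy. rewrite Rmin_left, Rmax_right in Hy by lra.
      apply continuity_pt_filterlim.
      apply (ex_derive_continuous (V := R_NormedModule)).
      eexists. apply (proj1 (H y Hy)).
    - rewrite Rmin_left, Rmax_right in Hc by lra.
      rewrite Rabs_mult, (Rabs_pos_eq (b - a)) by lra.
      apply Rmult_le_compat_r; [lra|].
      eapply Rle_trans; [apply re_le_Cmod | apply H, Hc]. }
  assert (Hi : (Rabs (Im (h b) - Im (h a)) <= D * (b - a))%R).
  { destruct (MVT_gen (fun y => Im (h y)) a b (fun y => Im (d y))) as [c [Hc ->]].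
    - intros y Hy. rewrite Rmin_left, Rmax_right in Hy by lra. apply H; lra.
    - intros y Hy. rewrite Rmin_left, Rmax_right in Hy by lra.
      apply continuity_pt_filterlim.
      apply (ex_derive_continuous (V := R_NormedModule)).
      eexists. apply (proj1 (H y Hy)).
    - rewrite Rmin_left, Rmax_right in Hc by lra.
      rewrite Rabs_mult, (Rabs_pos_eq (b - a)) by lra.
      apply Rmult_le_compat_r; [lra|].
      eapply Rle_trans; [|apply H, Hc]. eapply Rle_trans; [|apply Rmax_Cmod]. apply Rmax_r. }
  replace (h b - h a) with
    (RtoC (Re (h b) - Re (h a)) + Ci * RtoC (Im (h b) - Im (h a))).
  - eapply Rle_trans; [apply Cmod_triangle|].
    rewrite Cmod_mult, Cmod_Ci, !Cmod_R. lra.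
  - apply C_ext; unfold Ci, Cmult, Cplus, Copp, RtoC, Re, Im; simpl; ring.
Qed.

(** * The principal logarithm on the right half-plane *)

Lemma Re_gt_0_neq_0 (z : C) : (0 < Re z)%R -> z <> 0.
Proof. intros H ->. simpl in H. lra. Qed.

Lemma Cmod_sqr (z : C) : (Cmod z * Cmod z = Re z ^ 2 + Im z ^ 2)%R.
Proof. rewrite <- Cmod2_alt. ring. Qed.

(** The [acos] form of the argument has its case split and a singular derivative on the positive
    real axis, inside the region of interest; the [atan] form is smooth there. *)
Lemma Carg_atan (z : C) : (0 < Re z)%R -> Carg z = atan (Im z / Re z).
Proof.
  intros Hz. pose proof (Re_gt_0_neq_0 z Hz) as Hnz.
  apply Cmod_gt_0 in Hnz. pose proof (Cmod_sqr z) as Hsq.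
  assert (Hpos : (0 < Re z / Cmod z)%R) by (apply Rdiv_lt_0_compat; assumption).
  assert (Hac : acos (Re z / Cmod z) = atan (Rabs (Im z) / Re z)).
  { rewrite acos_atan by exact Hpos. f_equal.
    replace (1 - (Re z / Cmod z)²)%R with ((Rabs (Im z) / Cmod z)²)%R.
    - rewrite sqrt_Rsqr.
      + field. lra.
      + apply Rdiv_le_0_compat; [apply Rabs_pos | assumption].
    - unfold Rsqr. apply (Rmult_eq_reg_r (Cmod z * Cmod z)); [|nra].
      replace (Rabs (Im z) / Cmod z * (Rabs (Im z) / Cmod z) * (Cmod z * Cmod z))%R
        with (Rabs (Im z) * Rabs (Im z))%R by (field; lra).
      rewrite <- Rabs_mult, Rabs_pos_eq by nra.
      transitivity (Cmod z * Cmod z - Re z * Re z)%R; [rewrite Hsq; ring | field; lra]. }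
  unfold Carg. rewrite Hac. destruct (Rle_dec 0 (Im z)) as [H|H].
  - now rewrite Rabs_pos_eq.
  - rewrite Rabs_left, <- atan_opp by lra. f_equal. field. lra.
Qed.

Lemma ln_Cmod (z : C) : (0 < Re z)%R -> ln (Cmod z) = (/ 2 * ln (Re z ^ 2 + Im z ^ 2))%R.
Proof.
  intros Hz. rewrite <- Cmod_sqr.
  assert (0 < Cmod z)%R by (apply Cmod_gt_0, Re_gt_0_neq_0, Hz).
  rewrite ln_mult by assumption. field.
Qed.

Lemma Cexp_Clog (z : C) : (0 < Re z)%R -> Cexp (Clog z) = z.
Proof.
  intros Hz. pose proof (Re_gt_0_neq_0 z Hz) as Hnz. apply Cmod_gt_0 in Hnz.
  pose proof (Cmod_sqr z) as Hsq.
  assert (Hs : (sqrt (1 + (Im z / Re z)²) = Cmod z / Re z)%R).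
  { replace (1 + (Im z / Re z)²)%R with ((Cmod z / Re z)²)%R.
    - apply sqrt_Rsqr, Rlt_le, Rdiv_lt_0_compat; assumption.
    - unfold Rsqr. transitivity ((Cmod z * Cmod z) / (Re z * Re z))%R; [field; lra|].
      rewrite Hsq. field. lra. }
  unfold Cexp, Clog; simpl. rewrite exp_ln by assumption.
  rewrite Carg_atan, cos_atan, sin_atan, Hs by assumption.
  apply C_ext; simpl; field; lra.
Qed.

Lemma Cderiv_Clog (h : R -> C) (x : R) (d : C) :
  (0 < Re (h x))%R -> Cderiv h x d -> Cderiv (fun y => Clog (h y)) x (d / h x).
Proof.
  intros Hx [H1 H2].
  assert (Hloc : locally x (fun y => (0 < Re (h y))%R)).
  { assert (Hc : continuous (fun y => Re (h y)) x)
      by (apply (ex_derive_continuous (V := R_NormedModule)); eexists; exact H1).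
    apply Hc. apply (open_gt 0%R). exact Hx. }
  set (f := fun y => Re (h y)) in *. set (g := fun y => Im (h y)) in *.
  assert (E1 : Derive (fun y => f y) x = Re d) by now apply is_derive_unique.
  assert (E2 : Derive (fun y => g y) x = Im d) by now apply is_derive_unique.
  assert (Hh : h x = (f x, g x)) by (apply C_ext; reflexivity).
  change (0 < f x)%R in Hx.
  split.
  - apply (is_derive_ext_loc (fun y => / 2 * ln (f y ^ 2 + g y ^ 2))%R).
    + revert Hloc; apply filter_imp; intros y Hy. symmetry. now apply ln_Cmod.
    + auto_derive.
      * repeat split; try (eexists; eassumption). nra.
      * rewrite E1, E2, Hh. unfold Cdiv, Cinv, Cmult, Re, Im; simpl. field. nra.
  - apply (is_derive_ext_loc (fun y => atan (g y / f y))%R).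
    + revert Hloc; apply filter_imp; intros y Hy. symmetry. now apply Carg_atan.
    + auto_derive.
      * repeat split; try (eexists; eassumption). lra.
      * rewrite E1, E2, Hh. unfold Cdiv, Cinv, Cmult, Re, Im; simpl. field. nra.
Qed.

(** * Series of the exponential and the logarithm *)

Lemma INR_C_neq_0 (n : nat) : RtoC (INR (S n)) <> 0.
Proof. intros H. apply RtoC_inj in H. revert H. apply not_0_INR. lia. Qed.

Lemma fact_C_neq_0 (n : nat) : RtoC (INR (fact n)) <> 0.
Proof. intros H. apply RtoC_inj in H. revert H. apply INR_fact_neq_0. Qed.

Lemma RtoC_INR_fact_S (n : nat) :
  RtoC (INR (fact (S n))) = RtoC (INR (S n)) * RtoC (INR (fact n)).
Proof. now rewrite <- RtoC_mult, <- mult_INR. Qed.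

(* The derivative in [y] of [exp(- y z)] times the Taylor polynomial of
   [exp(y z)] consists of a single monomial. *)
Lemma Cexp_series (z : C) : Cseries (fun j => z ^ j / RtoC (INR (fact j))) (Cexp z).
Proof.
  set (T := fun (y : R) j => (RtoC y * z) ^ j / RtoC (INR (fact j))).
  set (g := fun N y => Cexp (RtoC y * (- z)) * Csum (T y) N).
  assert (HT : forall y N, Cderiv (fun y => Csum (T y) N) y
                 (z * (Csum (T y) N - T y N))).
  { intros y N; induction N as [|N IH].
    - rewrite Csum_0. replace (z * (T y 0%nat - T y 0%nat)) with (RtoC 0) by ring.
      apply (Cderiv_ext (fun _ => 1)); [|apply Cderiv_const].
      intros x. rewrite Csum_0. unfold T. simpl. field.
    - eapply Cderiv_ext; [intros x; symmetry; apply Csum_S|].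
      replace (z * (Csum (T y) (S N) - T y (S N))) with
        (z * (Csum (T y) N - T y N) + z * T y N) by (rewrite Csum_S; ring).
      apply Cderiv_plus; [exact IH|].
      apply (Cderiv_ext (fun x => / RtoC (INR (fact (S N))) * (0 + RtoC x * z) ^ S N)).
      { intros x. unfold T, Cdiv. rewrite Cplus_0_l. ring. }
      replace (z * T y N) with (/ RtoC (INR (fact (S N))) *
        (RtoC (INR (S N)) * (0 + RtoC y * z) ^ N * z)).
      + apply Cderiv_scal, (Cderiv_pow (fun x => 0 + RtoC x * z)), Cderiv_affine.
      + unfold T. rewrite RtoC_INR_fact_S, Cplus_0_l. field.
        split; [apply fact_C_neq_0 | apply INR_C_neq_0]. }
  assert (Hg : forall y N, Cderiv (g N) y (- (z * (Cexp (RtoC y * (- z)) * T y N)))).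
  { intros y N. unfold g.
    replace (- (z * (Cexp (RtoC y * (- z)) * T y N))) with
      ((- z * Cexp (RtoC y * (- z))) * Csum (T y) N
       + Cexp (RtoC y * (- z)) * (z * (Csum (T y) N - T y N))) by ring.
    apply (Cderiv_mult (fun y => Cexp (RtoC y * (- z))) (fun y => Csum (T y) N));
      [|apply HT].
    apply (Cderiv_Cexp (fun y => RtoC y * (- z))).
    apply (Cderiv_ext (fun y => 0 + RtoC y * (- z))); [intros x; ring|].
    apply Cderiv_affine. }
  assert (Hlim : Clim (fun N => g N 1%R) 1).
  { apply Clim_le with
      (e := fun N => (2 * (Cmod z * exp (Cmod z)) * (Cmod z ^ N / INR (fact N)))%R).
    - intros N. replace (RtoC 1) with (g N 0%R) at 1.
      2: { unfold g. rewrite Cmult_0_l, Cexp_0, Cmult_1_l.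
           induction N as [|N IH].
           - rewrite Csum_0. unfold T. simpl. field.
           - rewrite Csum_S, IH. unfold T. rewrite Cpow_S, Cmult_0_l. unfold Cdiv. ring. }
      replace (2 * (Cmod z * exp (Cmod z)) * (Cmod z ^ N / INR (fact N)))%R with
        (2 * (Cmod z * (exp (Cmod z) * (Cmod z ^ N / INR (fact N)))) * (1 - 0))%R by ring.
      apply (Cderiv_mean_value (g N) (fun y => - (z * (Cexp (RtoC y * (- z)) * T y N))));
        [lra | intros y Hy; split; [apply Hg|]].
      rewrite Cmod_opp, !Cmod_mult, Cmod_Cexp.
      apply Rmult_le_compat_l; [apply Cmod_ge_0|].
      assert (Hyz : (Cmod (RtoC y * z) <= Cmod z)%R).
      { rewrite Cmod_mult, Cmod_R, Rabs_pos_eq by apply Hy.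
        pose proof (Cmod_ge_0 z). nra. }
      apply Rmult_le_compat; [left; apply exp_pos | apply Cmod_ge_0 | |].
      + replace (RtoC y * - z) with (- (RtoC y * z)) by ring.
        destruct (Req_dec (Re (- (RtoC y * z))) (Cmod z)) as [->|Hne]; [lra|].
        left. apply exp_increasing.
        assert (Re (- (RtoC y * z)) <= Cmod z)%R; [|lra].
        eapply Rle_trans; [apply Rle_abs|].
        eapply Rle_trans; [apply re_le_Cmod|]. now rewrite Cmod_opp.
      + unfold T. rewrite Cmod_div, Cmod_pow, (Cmod_R (INR _)) by apply fact_C_neq_0.
        rewrite (Rabs_pos_eq (INR _)) by apply pos_INR.
        apply Rmult_le_compat_r; [left; apply Rinv_0_lt_compat, INR_fact_lt_0|].
        apply pow_incr. split; [apply Cmod_ge_0 | exact Hyz].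
    - replace (Finite 0) with (Rbar_mult (2 * (Cmod z * exp (Cmod z)))%R 0)
        by (simpl; f_equal; ring).
      apply is_lim_seq_scal_l. apply is_lim_seq_Reals, cv_speed_pow_fact. }
  apply Cseries_Clim.
  replace (Cexp z) with (Cexp z * 1) by ring.
  eapply Clim_ext; [|apply (Clim_scal (Cexp z)), Hlim].
  intros N. cbv beta. unfold g. rewrite Cmult_assoc, <- Cexp_plus.
  replace (z + RtoC 1 * - z) with (RtoC 0) by ring. rewrite Cexp_0, Cmult_1_l.
  apply Csum_ext. intros k _. unfold T. now rewrite Cmult_1_l.
Qed.

(** The point b - y t runs from [b] to [b - t] inside the right half-plane, so no branch question
    arises. With w = t / b, the derivative in y of -log(b - y t) minus the partial sum is the
    geometric remainder w (y w)^(N+1) / (1 - y w), and the mean value inequality bounds the error by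
    a multiple of |w|^N. *)
Lemma Clog_series (b t : C) :
  (Cmod t < Re b)%R ->
  Cseries (fun j => (t / b) ^ S j / RtoC (INR (S j))) (Clog b - Clog (b - t)).
Proof.
  intros Ht.
  assert (Hb : (0 < Re b)%R) by (pose proof (Cmod_ge_0 t); lra).
  pose proof (Re_gt_0_neq_0 b Hb) as Hb0.
  set (w := t / b).
  assert (Hw : (Cmod w < 1)%R).
  { unfold w. rewrite Cmod_div by assumption.
    apply (Rdiv_lt_1 (Cmod t)); [now apply Cmod_gt_0|].
    pose proof (re_le_Cmod b). pose proof (Rle_abs (Re b)). lra. }
  set (g := fun N y => - (1) * Clog (b + RtoC y * (- t)) +
     - (1) * Csum (fun j => (RtoC y * w) ^ S j / RtoC (INR (S j))) N).
  assert (Hyw : forall y, (0 <= y <= 1)%R -> (Cmod (RtoC y * w) <= Cmod w)%R).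
  { intros y Hy. rewrite Cmod_mult, Cmod_R, Rabs_pos_eq by apply Hy.
    pose proof (Cmod_ge_0 w). nra. }
  assert (H1w : forall y, (0 <= y <= 1)%R -> (1 - Cmod w <= Cmod (1 - RtoC y * w))%R).
  { intros y Hy. pose proof (Cmod_triangle (1 - RtoC y * w) (RtoC y * w)) as H.
    replace (1 - RtoC y * w + RtoC y * w) with (RtoC 1) in H by ring.
    rewrite Cmod_1 in H. specialize (Hyw y Hy). lra. }
  assert (H1w0 : forall y, (0 <= y <= 1)%R -> 1 - RtoC y * w <> 0).
  { intros y Hy. apply Cmod_gt_0. specialize (H1w y Hy). lra. }
  assert (Hg : forall y N, (0 <= y <= 1)%R ->
     Cderiv (g N) y (w * (RtoC y * w) ^ S N / (1 - RtoC y * w))).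
  { intros y N Hy.
    replace (w * (RtoC y * w) ^ S N / (1 - RtoC y * w)) with
      (- (1) * (- t / (b + RtoC y * (- t))) +
       - (1) * Csum (fun j => w * (RtoC y * w) ^ j) N).
    - apply Cderiv_plus.
      + apply Cderiv_scal, Cderiv_Clog; [|apply Cderiv_affine].
        assert (Hre : (Re (RtoC y * t) <= Cmod t)%R).
        { eapply Rle_trans; [apply Rle_abs|]. eapply Rle_trans; [apply re_le_Cmod|].
          rewrite Cmod_mult, Cmod_R, Rabs_pos_eq by apply Hy.
          pose proof (Cmod_ge_0 t). nra. }
        replace (Re (b + RtoC y * - t)) with (Re b - Re (RtoC y * t))%R; [lra|].
        unfold Re; simpl; ring.
      + apply Cderiv_scal.
        apply (Cderiv_Csum (fun j y => (RtoC y * w) ^ S j / RtoC (INR (S j)))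
                           (fun j y => w * (RtoC y * w) ^ j)).
        intros k _.
        apply (Cderiv_ext (fun x => / RtoC (INR (S k)) * (0 + RtoC x * w) ^ S k)).
        { intros x. rewrite Cplus_0_l. unfold Cdiv. ring. }
        replace (w * (RtoC y * w) ^ k) with
          (/ RtoC (INR (S k)) * (RtoC (INR (S k)) * (0 + RtoC y * w) ^ k * w)).
        * apply Cderiv_scal, (Cderiv_pow (fun x => 0 + RtoC x * w)), Cderiv_affine.
        * rewrite Cplus_0_l. field. apply INR_C_neq_0.
    - assert (Hgeo : Csum (fun j => w * (RtoC y * w) ^ j) N =
                     w * (1 - (RtoC y * w) ^ S N) / (1 - RtoC y * w)).
      { induction N as [|N IH].
        - rewrite Csum_0. simpl. field. now apply H1w0.
        - rewrite Csum_S, IH, !Cpow_S. field. now apply H1w0. }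
      rewrite Hgeo.
      replace (- t / (b + RtoC y * - t)) with (- w / (1 - RtoC y * w)).
      + field. now apply H1w0.
      + pose proof (H1w0 y Hy) as H0.
        assert (b + RtoC y * - t <> 0).
        { replace (b + RtoC y * - t) with (b * (1 - RtoC y * w))
            by (unfold w; field; assumption).
          now apply Cmult_neq_0. }
        unfold w. field. repeat split; try assumption. }
  apply Cseries_Clim.
  apply Clim_le with (e := fun N => (2 * / (1 - Cmod w) * Cmod w ^ N)%R).
  - intros N. rewrite <- Cmod_opp.
    replace (- (Csum (fun j => w ^ S j / RtoC (INR (S j))) N - (Clog b - Clog (b - t))))
      with (g N 1%R - g N 0%R).
    + replace (2 * / (1 - Cmod w) * Cmod w ^ N)%R with
        (2 * (Cmod w ^ N / (1 - Cmod w)) * (1 - 0))%R by (unfold Rdiv; ring).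
      apply Cderiv_mean_value with
        (d := fun y => w * (RtoC y * w) ^ S N / (1 - RtoC y * w)); [lra|].
      intros y Hy; split; [now apply Hg|].
      rewrite Cmod_div, Cmod_mult, Cmod_pow by now apply H1w0.
      specialize (H1w y Hy). specialize (Hyw y Hy).
      pose proof (Cmod_ge_0 w). pose proof (Cmod_ge_0 (RtoC y * w)).
      apply Rmult_le_compat.
      * apply Rmult_le_pos; [assumption | now apply pow_le].
      * left. apply Rinv_0_lt_compat. lra.
      (* The surplus factor |w| |y w| of the remainder is at most 1 and is dropped. *)
      * rewrite <- tech_pow_Rmult.
        assert (Cmod (RtoC y * w) ^ N <= Cmod w ^ N)%R by (apply pow_incr; lra).
        pose proof (pow_le (Cmod (RtoC y * w)) N H0).
        rewrite <- (Rmult_1_l (Cmod w ^ N)), <- Rmult_assoc.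
        apply Rmult_le_compat; try assumption; nra.
      * apply Rinv_le_contravar; lra.
    + unfold g. rewrite !Cmult_0_l, Cplus_0_r, !Cmult_1_l.
      replace (Csum (fun j => RtoC 0 ^ S j / RtoC (INR (S j))) N) with (RtoC 0).
      * unfold Cminus. ring.
      * induction N as [|N IH].
        -- rewrite Csum_0, Cpow_S, Cmult_0_l. unfold Cdiv. ring.
        -- rewrite Csum_S, <- IH, Cpow_S, Cmult_0_l. unfold Cdiv. ring.
  - replace (Finite 0) with (Rbar_mult (2 * / (1 - Cmod w))%R 0)
      by (simpl; f_equal; ring).
    apply is_lim_seq_scal_l, is_lim_seq_geom. rewrite Rabs_pos_eq; [lra | apply Cmod_ge_0].
Qed.

(** * Differences of powers and logarithms *)

(** Comparison with the telescoping differences of 1 / (m + c), after the index is raised by one. *)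
Lemma ex_series_inv_sqr (c : R) :
  (0 < c)%R -> ex_series (fun m => / (INR m + c) ^ 2)%R.
Proof.
  intros Hc. apply ex_series_incr_1.
  apply (ex_series_le (V := R_CompleteNormedModule)) with
    (b := fun m => (/ (INR m + c) - / (INR (S m) + c))%R).
  - intros m. pose proof (pos_INR m).
    assert (0 < / (INR (S m) + c) ^ 2)%R.
    { rewrite S_INR. apply Rinv_0_lt_compat, pow_lt. lra. }
    change (norm (/ (INR (S m) + c) ^ 2)%R) with (Rabs (/ (INR (S m) + c) ^ 2)%R).
    rewrite Rabs_pos_eq by lra.
    replace (/ (INR m + c) - / (INR (S m) + c))%R with
      (/ ((INR m + c) * (INR (S m) + c)))%R by (rewrite S_INR; field; lra).
    rewrite S_INR. apply Rinv_le_contravar; nra.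
  - exists (/ c)%R. change (is_lim_seq (sum_n (fun m => (/ (INR m + c) - / (INR (S m) + c))%R)) (/ c)%R).
    apply is_lim_seq_ext with (u := fun n => (/ c - / (INR (S n) + c))%R).
    + intros n; induction n as [|n IH].
      * rewrite sum_O. simpl (INR 0). now rewrite Rplus_0_l.
      * rewrite sum_Sn, <- IH. change plus with Rplus. ring.
    + replace (Finite (/ c)) with (Finite (/ c - 0)) by (f_equal; ring).
      apply is_lim_seq_minus'; [apply is_lim_seq_const|].
      apply (is_lim_seq_incr_1 (fun n => / (INR n + c))%R).
      apply (is_lim_seq_inv _ p_infty); [|easy].
      apply is_lim_seq_plus with (l1 := p_infty) (l2 := c);
        [apply is_lim_seq_INR | apply is_lim_seq_const | easy].
Qed.

(** [h] is a chain of successive derivatives. Its unit differences form such a chain again, shorter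
    by one, whose last member the mean value inequality bounds by twice the bound on the lost one;
    hence 2^K. *)
Lemma fdiffs_deriv_bound (K : nat) (h : nat -> R -> C) (m : nat) (M : R) :
  (forall i y, (i < K)%nat -> (0 <= y)%R -> Cderiv (h i) y (h (S i) y)) ->
  (forall y, (INR m <= y <= INR m + INR K)%R -> (Cmod (h K y) <= M)%R) ->
  (Cmod (fdiffs K (fun n => h 0%nat (INR n)) m) <= 2 ^ K * M)%R.
Proof.
  revert h M; induction K as [|K IH]; intros h M Hd HM.
  - simpl. rewrite Rmult_1_l. apply HM. simpl. lra.
  - simpl fdiffs.
    set (h' := fun i y => h i (y + 1)%R - h i y).
    rewrite (fdiffs_ext K _ (fun n => h' 0%nat (INR n))).
    2: { intros n. unfold fdiff, h'. now rewrite S_INR. }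
    replace (2 ^ S K * M)%R with (2 ^ K * (2 * M))%R by (simpl; ring).
    apply IH.
    + intros i y Hi Hy. unfold h'.
      replace (h (S i) (y + 1)%R - h (S i) y) with
        (h (S i) (y + 1)%R + - (1) * h (S i) y) by ring.
      apply (Cderiv_ext (fun x => h i (x + 1)%R + - (1) * h i x)); [intros x; ring|].
      apply Cderiv_plus; [|apply Cderiv_scal, Hd; [lia | lra]].
      destruct (Hd i (y + 1)%R) as [H1 H2]; [lia | lra |].
      assert (Hs : is_derive (fun x => x + 1)%R y 1%R) by (auto_derive; [auto | ring]).
      split.
      * evar_last; [apply (is_derive_comp (fun x => Re (h i x)) (fun x => x + 1)%R _ _ _ H1 Hs)|].
        apply Rmult_1_l.
      * evar_last; [apply (is_derive_comp (fun x => Im (h i x)) (fun x => x + 1)%R _ _ _ H2 Hs)|].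
        apply Rmult_1_l.
    + intros y Hy. unfold h'.
      replace (2 * M)%R with (2 * M * ((y + 1) - y))%R by ring.
      apply Cderiv_mean_value with (d := h (S K)); [lra|].
      pose proof (pos_INR m).
      intros x Hx; split; [apply Hd; [lia | lra]|].
      apply HM. rewrite S_INR. lra.
Qed.

(* [log_factor s i j L] is the polynomial in [L = log x] such that
   [x ^ (- s - i) * log_factor s i j L] is the [i]-th derivative in [x] of
   [x ^ (- s) * (- L) ^ j / j!], the [j]-th Taylor coefficient of [x ^ (- s)] in [s]. *)
Fixpoint log_factor (s : C) (i j : nat) (L : C) : C :=
  match i with
  | O => (- L) ^ j / RtoC (INR (fact j))
  | S i' => match j with O => 0 | S j' => - log_factor s i' j' L end
            - (s + RtoC (INR i')) * log_factor s i' j L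
  end.

Lemma Cderiv_log_factor (s : C) (i j : nat) (h : R -> C) (x : R) (d : C) :
  Cderiv h x d ->
  Cderiv (fun y => log_factor s i j (h y)) x
    (match j with O => 0 | S j' => - log_factor s i j' (h x) end * d).
Proof.
  intros H. revert j; induction i as [|i IH]; intros j.
  - simpl. destruct j as [|j].
    + replace (0 * d) with (RtoC 0) by ring.
      apply (Cderiv_ext (fun _ => 1)); [|apply Cderiv_const]. intros y. simpl. field.
    + apply (Cderiv_ext (fun y => / RtoC (INR (fact (S j))) * (- (1) * h y) ^ S j)).
      { intros y. unfold Cdiv. rewrite Cmult_comm. f_equal. f_equal. ring. }
      replace (- ((- h x) ^ j / RtoC (INR (fact j))) * d) with
        (/ RtoC (INR (fact (S j))) *
          (RtoC (INR (S j)) * (- (1) * h x) ^ j * (- (1) * d))).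
      * apply Cderiv_scal, (Cderiv_pow (fun y => - (1) * h y)), Cderiv_scal, H.
      * replace (- (1) * h x) with (- h x) by ring.
        rewrite RtoC_INR_fact_S. field.
        split; [apply fact_C_neq_0 | apply INR_C_neq_0].
  - destruct j as [|j].
    + apply (Cderiv_ext (fun y => - (s + RtoC (INR i)) * log_factor s i 0 (h y))).
      { intros y. simpl. ring. }
      replace (0 * d) with (- (s + RtoC (INR i)) * (0 * d)) by ring.
      apply Cderiv_scal, (IH 0%nat).
    + apply (Cderiv_ext (fun y => - (1) * log_factor s i j (h y)
                            + - (s + RtoC (INR i)) * log_factor s i (S j) (h y))).
      { intros y. simpl. ring. }
      replace (- log_factor s (S i) j (h x) * d) with
        (- (1) * (match j with O => 0 | S j' => - log_factor s i j' (h x) end * d)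
         + - (s + RtoC (INR i)) * (- log_factor s i j (h x) * d))
        by (destruct j; simpl; ring).
      apply Cderiv_plus; apply Cderiv_scal; [apply IH | apply (IH (S j))].
Qed.

Lemma pow_div_fact_le_exp (x : R) (j : nat) :
  (0 <= x)%R -> (x ^ j / INR (fact j) <= exp x)%R.
Proof.
  intros Hx.
  assert (H : is_series (fun j => x ^ j / INR (fact j))%R (exp x)).
  { eapply is_series_ext; [|apply is_exp_Reals with (x := x)].
    intros n. unfold scal; simpl. rewrite pow_n_pow. reflexivity. }
  assert (Hpos : forall n, (0 <= x ^ n / INR (fact n))%R).
  { intros n. apply Rmult_le_pos; [now apply pow_le|].
    left; apply Rinv_0_lt_compat, INR_fact_lt_0. }
  apply Rle_trans with (sum_n (fun j => x ^ j / INR (fact j))%R j).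
  - destruct j as [|j]; [rewrite sum_O; lra|]. rewrite sum_Sn.
    assert (0 <= sum_n (fun j => x ^ j / INR (fact j))%R j)%R.
    { clear -Hpos. induction j as [|j IH]; [rewrite sum_O; apply Hpos|].
      rewrite sum_Sn. apply Rplus_le_le_0_compat; [exact IH | apply Hpos]. }
    change plus with Rplus. simpl in *. lra.
  - apply is_lim_seq_incr_compare with (u := sum_n (fun j => x ^ j / INR (fact j))%R);
      [exact H|].
    intros n. rewrite sum_Sn. change plus with Rplus. simpl.
    specialize (Hpos (S n)). simpl in Hpos. lra.
Qed.

(** Since |L|^j / j! <= e^|L|, one constant serves all [j]. This uniformity is what gives the Taylor
    series in [s] a radius of convergence of at least 1. *)
Lemma log_factor_bound (s : C) (i : nat) :
  exists M : R, (0 <= M)%R /\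
    forall j L, (Cmod (log_factor s i j L) <= M * exp (Cmod L))%R.
Proof.
  induction i as [|i [M [HM0 HM]]].
  - exists 1%R; split; [lra|]. intros j L. simpl.
    rewrite Cmod_div, Cmod_pow, Cmod_opp, Cmod_R, Rmult_1_l by apply fact_C_neq_0.
    rewrite Rabs_pos_eq by apply pos_INR.
    apply pow_div_fact_le_exp, Cmod_ge_0.
  - exists (M + Cmod (s + RtoC (INR i)) * M)%R.
    pose proof (Cmod_ge_0 (s + RtoC (INR i))) as Hs.
    split; [nra|]. intros j L. simpl. unfold Cminus.
    eapply Rle_trans; [apply Cmod_triangle|]. rewrite Cmod_opp, Cmod_mult.
    rewrite Rmult_plus_distr_r. apply Rplus_le_compat.
    + destruct j as [|j]; [|rewrite Cmod_opp; apply HM].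
      rewrite Cmod_0. apply Rmult_le_pos; [exact HM0 | left; apply exp_pos].
    + rewrite Rmult_assoc. apply Rmult_le_compat_l; [exact Hs | apply HM].
Qed.

(** Apart from the factor lambda^m, the index [j = 0] yields the terms of [Phi] and [j = 1] those of
    its derivative in [s]. *)
Definition taylor_term (a s : C) (j m : nat) : C :=
  Cexp (- s * Clog (RtoC (INR m) + a)) *
  ((- Clog (RtoC (INR m) + a)) ^ j / RtoC (INR (fact j))).

Lemma exp_le (x y : R) : (x <= y)%R -> (exp x <= exp y)%R.
Proof. intros [H | ->]; [left; now apply exp_increasing | right; reflexivity]. Qed.

Lemma Rabs_Carg_le (z : C) : (0 < Re z)%R -> (Rabs (Carg z) <= 2)%R.
Proof.
  intros Hz. rewrite Carg_atan by exact Hz. pose proof (atan_bound (Im z / Re z)).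
  pose proof PI_4. apply Rabs_le. lra.
Qed.

(** With x = m + a as a real variable m, the [K]-th derivative is at most of size |x|^(-Re s - K)
    e^|log x|, hence |x|^(1 - Re s - K) up to a constant; the threshold 3 makes this a multiple of
    |x|^(-2) at most. *)
Lemma fdiffs_taylor_term_bound (a s : C) (K : nat) :
  (0 < Re a)%R -> (3 <= Re s + INR K)%R ->
  exists M : R, forall j m,
    (Cmod (fdiffs K (taylor_term a s j) m) <= M * / (INR m + Re a) ^ 2)%R.
Proof.
  intros Ha HK.
  destruct (log_factor_bound s K) as [M [HM0 HM]].
  set (c := Rabs (ln (Re a))).
  set (kappa := (Re s + INR K - 3)%R).
  (* In the exponent, [2 * Rabs (Im s)] absorbs [Im s * Carg z], [2 * c + 2] absorbs |log x| - ln
     |x|, and the last term absorbs the surplus power |x|^(-kappa), since |x| >= Re a. *)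
  set (D := exp (2 * Rabs (Im s) + 2 * c + 2 - kappa * ln (Re a))%R).
  exists (2 ^ K * (M * D))%R. intros j m.
  set (L := fun x : R => Clog (RtoC x + a)).
  set (h := fun i x => Cexp (- (s + RtoC (INR i)) * L x) * log_factor s i j (L x)).
  assert (Hre : forall x, (Re (RtoC x + a) = x + Re a)%R) by reflexivity.
  rewrite (fdiffs_ext K _ (fun n => h 0%nat (INR n))).
  2: { intros n. unfold taylor_term, h, L. simpl.
       replace (s + 0) with s by ring. reflexivity. }
  rewrite Rmult_assoc. apply fdiffs_deriv_bound.
  - intros i x _ Hx. unfold h.
    assert (HL : Cderiv L x (Cexp (- L x))).
    { replace (Cexp (- L x)) with (RtoC 1 / (RtoC x + a)).
      - apply (Cderiv_Clog (fun x => RtoC x + a)); [rewrite Hre; lra|].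
        apply (Cderiv_ext (fun x => a + RtoC x * 1)); [intros y; ring|].
        apply Cderiv_affine.
      - unfold L. rewrite Cexp_opp, Cexp_Clog by (rewrite Hre; lra).
        unfold Cdiv. ring. }
    replace (Cexp (- (s + RtoC (INR (S i))) * L x) * log_factor s (S i) j (L x)) with
      ((- (s + RtoC (INR i)) * Cexp (- L x)) * Cexp (- (s + RtoC (INR i)) * L x) *
         log_factor s i j (L x) +
       Cexp (- (s + RtoC (INR i)) * L x) *
         (match j with O => 0 | S j' => - log_factor s i j' (L x) end * Cexp (- L x))).
    + apply (Cderiv_mult (fun x => Cexp (- (s + RtoC (INR i)) * L x))
                         (fun x => log_factor s i j (L x))).
      * apply (Cderiv_Cexp (fun x => - (s + RtoC (INR i)) * L x)).
        now apply Cderiv_scal.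
      * now apply Cderiv_log_factor.
    + replace (- (s + RtoC (INR (S i))) * L x) with
        (- (s + RtoC (INR i)) * L x + - L x) by (rewrite S_INR, RtoC_plus; ring).
      rewrite Cexp_plus. simpl log_factor. ring.
  - intros x Hx. pose proof (pos_INR m) as Hm.
    assert (Hxa : (INR m + Re a <= Re (RtoC x + a))%R) by (rewrite Hre; lra).
    assert (Hx0 : (0 < Re (RtoC x + a))%R) by lra.
    set (z := RtoC x + a) in *.
    assert (Hmod : (INR m + Re a <= Cmod z)%R).
    { eapply Rle_trans; [exact Hxa|]. eapply Rle_trans; [apply Rle_abs | apply re_le_Cmod]. }
    assert (Hl1 : (ln (INR m + Re a) <= ln (Cmod z))%R) by (apply ln_le; lra).
    assert (Hl2 : (ln (Re a) <= ln (Cmod z))%R) by (apply ln_le; lra).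
    pose proof (Rabs_Carg_le z Hx0) as Harg.
    assert (HLmod : (Cmod (L x) <= ln (Cmod z) + 2 * c + 2)%R).
    { unfold L. fold z. unfold Clog.
      replace ((ln (Cmod z), Carg z) : C) with (RtoC (ln (Cmod z)) + Ci * RtoC (Carg z)).
      - eapply Rle_trans; [apply Cmod_triangle|].
        rewrite Cmod_mult, Cmod_Ci, !Cmod_R.
        assert (Rabs (ln (Cmod z)) <= ln (Cmod z) + 2 * c)%R; [|lra].
        unfold c. pose proof (Rle_abs (- ln (Re a))) as H. rewrite Rabs_Ropp in H.
        apply Rabs_le. pose proof (Rabs_pos (ln (Re a))). lra.
      - apply C_ext; unfold Ci, Cmult, Cplus, RtoC, Re, Im; simpl; ring. }
    unfold h. rewrite Cmod_mult, Cmod_Cexp.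
    apply Rle_trans with (exp (Re (- (s + RtoC (INR K)) * L x)) * (M * exp (Cmod (L x))))%R.
    { apply Rmult_le_compat_l; [left; apply exp_pos | apply HM]. }
    rewrite (Rmult_assoc M), <- Rmult_assoc, (Rmult_comm _ M), Rmult_assoc.
    apply Rmult_le_compat_l; [exact HM0|].
    replace (/ (INR m + Re a) ^ 2)%R with (exp (- 2 * ln (INR m + Re a)))%R.
    2: { replace (- 2 * ln (INR m + Re a))%R with (- (ln (INR m + Re a) + ln (INR m + Re a)))%R by ring.
         rewrite exp_Ropp, exp_plus, exp_ln by lra. f_equal. ring. }
    unfold D. rewrite <- !exp_plus. apply exp_le.
    replace (Re (- (s + RtoC (INR K)) * L x)) with
      (- (Re s + INR K) * ln (Cmod z) + Im s * Carg z)%R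
      by (unfold L; fold z; unfold Clog, Cmult, Copp, Cplus, RtoC, Re, Im; simpl; ring).
    assert (Him : (Im s * Carg z <= 2 * Rabs (Im s))%R).
    { eapply Rle_trans; [apply Rle_abs|]. rewrite Rabs_mult.
      pose proof (Rabs_pos (Im s)). nra. }
    assert (Hk : (kappa * ln (Re a) <= kappa * ln (Cmod z))%R).
    { apply Rmult_le_compat_l; [unfold kappa; lra | exact Hl2]. }
    unfold kappa in *. lra.
Qed.

(** * Entire functions *)

(** The sum is continuous at 0, where its value is [c 0], and it vanishes along r / (n + 2). *)
Lemma pseries_zero_coef_0 (c : nat -> R) (r : R) :
  (0 < r)%R -> (forall x, (0 < x < r)%R -> is_pseries c x 0%R) -> c 0%nat = 0%R.
Proof.
  intros Hr H.
  assert (HCV : Rbar_le (r / 2)%R (CV_radius c)).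
  { apply (proj1 (CV_radius_bounded c)).
    destruct (filterlim_bounded (fun n => c n * (r / 2) ^ n)%R) as [M HM].
    - exists 0%R. apply ex_series_lim_0. exists 0%R. apply is_pseries_R, H. lra.
    - now exists M. }
  assert (H0 : Rbar_lt (Rabs 0) (CV_radius c)).
  { rewrite Rabs_R0. eapply Rbar_lt_le_trans; [|exact HCV]. simpl. lra. }
  pose proof (PSeries_continuity c 0 H0) as Hc. rewrite continuity_pt_filterlim in Hc.
  rewrite <- (PSeries_0 c).
  assert (Hl : is_lim_seq (fun n => PSeries c (r / INR (n + 2))) (PSeries c 0)).
  { refine (filterlim_comp _ _ _ (fun n : nat => (r / INR (n + 2))%R) _ _ _ _ _ Hc).
    change (is_lim_seq (fun n => (r * / INR (n + 2))%R) 0).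
    replace (Finite 0) with (Rbar_mult r 0) by (simpl; f_equal; ring).
    apply is_lim_seq_scal_l. apply (is_lim_seq_incr_n (fun n => / INR n)%R).
    apply (is_lim_seq_inv _ p_infty); [apply is_lim_seq_INR | easy]. }
  apply is_lim_seq_unique in Hl.
  rewrite (Lim_seq_ext _ (fun _ => 0%R)), Lim_seq_const in Hl.
  - now injection Hl.
  - intros n. apply is_pseries_unique, H.
    assert (1 < INR (n + 2))%R by (apply lt_1_INR; lia).
    split; [apply Rdiv_lt_0_compat; lra|].
    apply (Rmult_lt_reg_r (INR (n + 2))); [lra|].
    replace (r / INR (n + 2) * INR (n + 2))%R with r by (field; lra). nra.
Qed.

(** Once the constant term is 0, the series can be divided by [x], and the induction continues with
    the shifted coefficients; the interval leaves out 0 to make the division legitimate. *)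
Lemma pseries_zero_coef (c : nat -> R) (r : R) :
  (0 < r)%R -> (forall x, (0 < x < r)%R -> is_pseries c x 0%R) -> forall n, c n = 0%R.
Proof.
  intros Hr H n; revert c H; induction n as [|n IH]; intros c H.
  - now apply pseries_zero_coef_0 with r.
  - apply (IH (PS_decr_1 c)). intros x Hx.
    replace 0%R with (scal (/ x)%R (plus 0%R (opp (c 0%nat)))).
    + apply (is_pseries_decr_1 (V := R_NormedModule)); [|now apply H]. change (/ x * x = 1)%R. field. lra.
    + rewrite (pseries_zero_coef_0 c r Hr H).
      change (/ x * (0 + - 0) = 0)%R. ring.
Qed.

Lemma Cpow_RtoC (h : R) (n : nat) : RtoC h ^ n = RtoC (h ^ n).
Proof. symmetry. apply RtoC_pow. Qed.

(** For real [h] the powers are real, so the series splits into two real power series, and zeros on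
    a one-sided real segment suffice. *)
Lemma analytic_zero_extend (d : nat -> C) (r : R) :
  (0 < r)%R ->
  (forall h, (0 < h < r)%R -> Cseries (fun n => d n * RtoC h ^ n) 0) ->
  forall n, d n = 0.
Proof.
  intros Hr H n.
  apply C_ext; simpl;
    [apply (pseries_zero_coef (fun n => Re (d n)) r Hr)
    |apply (pseries_zero_coef (fun n => Im (d n)) r Hr)];
    intros x Hx; specialize (H x Hx); apply Cseries_comp in H;
    apply is_pseries_R; [destruct H as [H _] | destruct H as [_ H]];
    (eapply is_series_ext; [|exact H]); intros k; cbv beta; rewrite Cpow_RtoC;
    [apply re_scal_r | apply im_scal_r].
Qed.

(** Equality is pushed to the left along the horizontal line through the point. At the leftmost
    abscissa reached, the difference of the two expansions vanishes just to the right, so all its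
    coefficients vanish and equality extends further left. *)
Lemma analytic_unique (F G : C -> C) :
  analytic F -> analytic G ->
  (forall s, (0 < Re s)%R -> F s = G s) -> forall s, F s = G s.
Proof.
  intros HF HG Heq [x1 y].
  set (P := fun x : R => forall x', (x <= x')%R -> F (x', y) = G (x', y)).
  destruct (classic (P x1)) as [Hx1 | Hx1]; [apply Hx1; lra | exfalso].
  (* The sign turns an infimum into a supremum: [- t0] is the infimum of the abscissae from which
     equality holds all the way to the right. *)
  destruct (completeness (fun t => P (- t)%R)) as [t0 [Hub Hleast]].
  { exists (- x1)%R. intros t Ht. destruct (Rle_dec t (- x1)) as [|Hn]; [assumption|].
    exfalso. apply Hx1. intros x' Hx'. apply Ht. lra. }
  { exists (-1)%R. intros x' Hx'. apply Heq. simpl. lra. }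
  assert (Habove : forall x', (- t0 < x')%R -> F (x', y) = G (x', y)).
  { intros x' Hx'.
    destruct (classic (exists t, P (- t)%R /\ (- x' < t)%R)) as [[t [Ht Htx]] | Hno].
    - apply Ht. lra.
    - exfalso. assert (t0 <= - x')%R; [|lra]. apply Hleast. intros t Ht.
      destruct (Rle_dec t (- x')) as [|Hn]; [assumption|].
      exfalso. apply Hno. exists t; split; [exact Ht | lra]. }
  set (s0 := (- t0, y)%R : C).
  destruct (HF s0) as [c [r [Hr Hc]]]. destruct (HG s0) as [c' [r' [Hr' Hc']]].
  set (rho := Rmin r r').
  assert (Hrho : (0 < rho)%R) by now apply Rmin_glb_lt.
  assert (Hd : forall s, (Cmod (s - s0) < rho)%R ->
     Cseries (fun n => (c n - c' n) * (s - s0) ^ n) (F s - G s)).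
  { intros s Hs. eapply Cseries_ext; [|apply Cseries_minus;
      [apply Hc, Rlt_le_trans with rho; [exact Hs | apply Rmin_l]
      |apply Hc', Rlt_le_trans with rho; [exact Hs | apply Rmin_r]]].
    intros n. cbv beta. ring. }
  assert (Hline : forall x, (x, y) - s0 = RtoC (x + t0)).
  { intros x. apply C_ext; simpl; ring. }
  assert (Hcoef : forall n, c n - c' n = 0).
  { apply (analytic_zero_extend _ rho Hrho). intros h Hh.
    specialize (Hd (h - t0, y)%R). rewrite Hline in Hd.
    replace (h - t0 + t0)%R with h in Hd by ring.
    rewrite Habove in Hd by lra.
    replace (G (h - t0, y)%R - G (h - t0, y)%R) with (RtoC 0) in Hd by ring.
    apply Hd. rewrite Cmod_R, Rabs_pos_eq; lra. }
  assert (t0 + rho / 2 <= t0)%R; [|lra].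
  apply Hub. intros x' Hx'.
  destruct (Rlt_dec (- t0) x') as [|Hn]; [now apply Habove|].
  apply Ceq_minus. apply (Cseries_unique (fun n => (c n - c' n) * ((x', y) - s0) ^ n)).
  - apply Hd. rewrite Hline, Cmod_R. apply Rabs_def1; lra.
  - eapply Cseries_ext; [|apply Cseries_zero]. intros n. cbv beta. rewrite Hcoef. ring.
Qed.

(** [C_derive] unfolds to limits in the real direction, so only real increments [h] occur. With |c
    n| rho^n <= M and |h| <= rho / 2, the terms from order 2 on are dominated by a geometric series
    of ratio 1/2, which gives the error 2 M |h| / rho^2. *)
Lemma C_derive_power_series (F : C -> C) (s0 : C) (c : nat -> C) (r : R) :
  (0 < r)%R ->
  (forall s, (Cmod (s - s0) < r)%R -> Cseries (fun n => c n * (s - s0) ^ n) (F s)) ->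
  F s0 = c 0%nat /\ C_derive F s0 = c 1%nat.
Proof.
  intros Hr H.
  assert (H0 : F s0 = c 0%nat).
  { apply (Cseries_unique (fun n => c n * (s0 - s0) ^ n)).
    - apply H. replace (s0 - s0) with (RtoC 0) by ring. now rewrite Cmod_0.
    - replace (c 0%nat) with (c 0%nat * (s0 - s0) ^ 0 + 0) by (simpl; ring).
      apply Cseries_shift. eapply Cseries_ext; [|apply Cseries_zero].
      intros n. cbv beta. rewrite Cpow_S. ring. }
  split; [exact H0|].
  set (rho := (r / 2)%R).
  assert (Hrho : (0 < rho)%R) by (unfold rho; lra).
  destruct (Cseries_bounded (fun n => c n * RtoC rho ^ n) (F (s0 + RtoC rho))) as [M HM].
  { eapply Cseries_ext; [|apply H].
    - intros n. cbv beta. f_equal. f_equal. ring.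
    - replace (s0 + RtoC rho - s0) with (RtoC rho) by ring.
      rewrite Cmod_R, Rabs_pos_eq; unfold rho; lra. }
  assert (HM0 : (0 <= M)%R) by (eapply Rle_trans; [apply Cmod_ge_0 | apply (HM 0%nat)]).
  assert (Hq : forall h, h <> 0%R -> (Rabs h <= rho / 2)%R ->
    (Cmod ((F (s0 + RtoC h)%C - F s0) / RtoC h - c 1%nat) <= 2 * M / rho ^ 2 * Rabs h)%R).
  { intros h Hh Hhr.
    assert (Hh' : RtoC h <> 0) by (intros E; apply Hh, RtoC_inj, E).
    pose proof (Rabs_pos_lt h Hh) as Habs.
    assert (Hs : Cseries (fun n => c n * RtoC h ^ n) (F (s0 + RtoC h))).
    { eapply Cseries_ext; [|apply H].
      - intros n. cbv beta. f_equal. f_equal. ring.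
      - replace (s0 + RtoC h - s0) with (RtoC h) by ring. rewrite Cmod_R.
        unfold rho in *. lra. }
    assert (Hs2 : Cseries (fun n => c (S (S n)) * RtoC h ^ S (S n))
                    (F (s0 + RtoC h) - c 0%nat - c 1%nat * RtoC h)).
    { apply (Cseries_shift (fun n => c (S n) * RtoC h ^ S n)).
      apply (Cseries_shift (fun n => c n * RtoC h ^ n)).
      replace (c 0%nat * RtoC h ^ 0 + (c 1%nat * RtoC h ^ 1 +
        (F (s0 + RtoC h) - c 0%nat - c 1%nat * RtoC h))) with (F (s0 + RtoC h))
        by (simpl; ring).
      exact Hs. }
    replace ((F (s0 + RtoC h) - F s0) / RtoC h - c 1%nat) with
      ((F (s0 + RtoC h) - c 0%nat - c 1%nat * RtoC h) / RtoC h)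
      by (rewrite H0; field; exact Hh').
    rewrite Cmod_div, Cmod_R by exact Hh'.
    apply (Rmult_le_reg_r (Rabs h)); [exact Habs|].
    unfold Rdiv at 1. rewrite Rmult_assoc, Rinv_l, Rmult_1_r by lra.
    apply (Cseries_le _ (fun n => (M / rho ^ 2 * Rabs h * Rabs h * (/ 2) ^ n)%R) _ _) with (3 := Hs2).
    - intros n. rewrite Cmod_mult, Cmod_pow, Cmod_R.
      specialize (HM (S (S n))). rewrite Cmod_mult, Cmod_pow, Cmod_R, (Rabs_pos_eq rho) in HM by lra.
      assert (Hp : (Rabs h ^ n <= (rho * / 2) ^ n)%R).
      { apply pow_incr. split; [apply Rabs_pos | lra]. }
      rewrite Rpow_mult_distr in Hp.
      assert (Hrn : (0 < rho ^ n)%R) by now apply pow_lt.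
      assert (Hh2 : (0 < (/ 2) ^ n)%R) by (apply pow_lt; lra).
      replace (M / rho ^ 2 * Rabs h * Rabs h * (/ 2) ^ n)%R with
        ((M / rho ^ S (S n)) * (Rabs h * Rabs h * (rho ^ n * (/ 2) ^ n)))%R
        by (simpl; field; lra).
      apply Rmult_le_compat; [apply Cmod_ge_0 | apply pow_le, Rabs_pos | |].
      + apply Rle_div_r; [now apply pow_lt | exact HM].
      + simpl. rewrite Rmult_assoc. apply Rmult_le_compat_l; [lra|].
        apply Rmult_le_compat_l; [lra | exact Hp].
    - replace (2 * M / rho ^ 2 * Rabs h * Rabs h)%R with
        (M / rho ^ 2 * Rabs h * Rabs h * / (1 - / 2))%R by (field; lra).
      apply (is_series_scal_l (V := R_NormedModule) (M / rho ^ 2 * Rabs h * Rabs h)%R).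
      apply is_series_geom. rewrite Rabs_pos_eq; lra. }
  assert (Hlim : forall eps : posreal, exists delta : posreal, forall x : R,
    (Rabs (x - fst s0) < delta)%R -> x <> fst s0 ->
    (Cmod ((F (x, snd s0) - F s0) / ((x, snd s0) - s0) - c 1%nat) < eps)%R).
  (* The added 1 keeps [A] positive even when [M = 0], so that [eps / A] makes sense. *)
  { intros eps. set (A := (2 * M / rho ^ 2 + 1)%R).
    assert (HA : (0 < A)%R).
    { unfold A. assert (0 <= 2 * M / rho ^ 2)%R; [|lra].
      apply Rdiv_le_0_compat; [lra | now apply pow_lt]. }
    assert (Hdelta : (0 < Rmin (rho / 2) (eps / A))%R).
    { apply Rmin_glb_lt; [lra | apply Rdiv_lt_0_compat; [apply cond_pos | exact HA]]. }
    exists (mkposreal _ Hdelta). intros x Hx Hne. simpl in Hx.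
    set (h := (x - fst s0)%R) in *.
    assert (Hh : h <> 0%R) by (unfold h; lra).
    replace ((x, snd s0) : C) with (s0 + RtoC h)
      by (apply C_ext; unfold h; simpl; ring).
    replace (s0 + RtoC h - s0) with (RtoC h) by ring.
    pose proof (Rmin_l (rho / 2) (eps / A)). pose proof (Rmin_r (rho / 2) (eps / A)).
    eapply Rle_lt_trans; [apply Hq; [exact Hh | lra]|].
    apply Rle_lt_trans with (A * Rabs h)%R.
    - apply Rmult_le_compat_r; [apply Rabs_pos | unfold A; lra].
    - replace (pos eps) with (A * (eps / A))%R by (field; lra).
      apply Rmult_lt_compat_l; [exact HA | lra]. }
  unfold C_derive, C_lim. apply C_ext; unfold Re, Im; simpl fst; simpl snd.
  - rewrite (is_lim_unique _ _ (fst (c 1%nat))); [reflexivity|].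
    apply is_lim_spec. intros eps. destruct (Hlim eps) as [delta Hdelta].
    exists delta. intros x Hx Hne. eapply Rle_lt_trans; [|apply (Hdelta x Hx Hne)].
    eapply Rle_trans; [|apply re_le_Cmod]. right; reflexivity.
  - rewrite (is_lim_unique _ _ (snd (c 1%nat))); [reflexivity|].
    apply is_lim_spec. intros eps. destruct (Hlim eps) as [delta Hdelta].
    exists delta. intros x Hx Hne. eapply Rle_lt_trans; [|apply (Hdelta x Hx Hne)].
    eapply Rle_trans; [|apply Rmax_Cmod]. eapply Rle_trans; [|apply Rmax_r].
    right; reflexivity.
Qed.

(** * Analytic continuation in s *)

Lemma taylor_term_series (a s0 s : C) (m : nat) :
  Cseries (fun j => taylor_term a s0 j m * (s - s0) ^ j) (taylor_term a s 0 m).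
Proof.
  unfold taylor_term. set (L := Clog (RtoC (INR m) + a)).
  replace (Cexp (- s * L) * ((- L) ^ 0 / RtoC (INR (fact 0)))) with
    (Cexp (- s0 * L) * Cexp ((- L) * (s - s0))).
  - eapply Cseries_ext; [|apply Cseries_scal, Cexp_series].
    intros j. cbv beta. rewrite Cpow_mult_l. unfold Cdiv. ring.
  - rewrite <- Cexp_plus. simpl.
    replace (- s0 * L + - L * (s - s0)) with (- s * L) by ring. field.
Qed.

Section Continuation.
Context (lambda a : C) (hlambda : (Cmod lambda <= 1)%R) (hlambda1 : lambda <> RtoC 1)
  (ha : (0 < Re a)%R).

Lemma abel_sum_taylor_exists (s : C) (K j : nat) :
  (3 <= Re s + INR K)%R -> exists l, abel_sum lambda K (taylor_term a s j) l.
Proof.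
  intros HK. destruct (fdiffs_taylor_term_bound a s K ha HK) as [M HM].
  apply abel_sum_exists with (b := fun m => (M * / (INR m + Re a) ^ 2)%R);
    [assumption | intros m; apply HM |].
  apply (ex_series_scal_l (V := R_NormedModule) M), ex_series_inv_sqr, ha.
Qed.

Lemma abel_sum_taylor_add (s : C) (K d j : nat) (l : C) :
  (3 <= Re s + INR K)%R -> abel_sum lambda K (taylor_term a s j) l ->
  abel_sum lambda (d + K) (taylor_term a s j) l.
Proof.
  intros HK Hl; induction d as [|d IH]; [exact Hl|].
  destruct (fdiffs_taylor_term_bound a s (d + K) ha) as [M HM].
  { rewrite plus_INR. pose proof (pos_INR d). lra. }
  apply (abel_sum_up lambda hlambda hlambda1 (d + K)
    (taylor_term a s j) (fun m => (M * / (INR m + Re a) ^ 2)%R));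
    [intros m; apply HM | | exact IH].
  apply (ex_series_scal_l (V := R_NormedModule) M), ex_series_inv_sqr, ha.
Qed.

Lemma abel_sum_taylor_change (s : C) (K K' j : nat) (l : C) :
  (3 <= Re s + INR K)%R -> (3 <= Re s + INR K')%R ->
  abel_sum lambda K (taylor_term a s j) l -> abel_sum lambda K' (taylor_term a s j) l.
Proof.
  intros HK HK' Hl. destruct (abel_sum_taylor_exists s K' j HK') as [l' Hl'].
  replace l with l'; [exact Hl'|].
  (* Either order may be the larger, so both sums are raised to the common order [K + K']. *)
  apply (abel_sum_unique lambda (K + K') (taylor_term a s j));
    [now apply abel_sum_taylor_add|].
  rewrite Nat.add_comm. now apply abel_sum_taylor_add.
Qed.

Lemma abel_sum_taylor_all (s : C) :
  exists l, forall K, (3 <= Re s + INR K)%R -> abel_sum lambda K (taylor_term a s 0) l.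
Proof.
  destruct (INR_unbounded (3 - Re s)) as [K0 HK0].
  destruct (abel_sum_taylor_exists s K0 0) as [l Hl]; [lra|].
  exists l. intros K HK. apply abel_sum_taylor_change with K0; [lra | exact HK | exact Hl].
Qed.

Definition lerch (s : C) : C :=
  proj1_sig (constructive_indefinite_description _ (abel_sum_taylor_all s)).

Lemma lerch_abel_sum (s : C) (K : nat) :
  (3 <= Re s + INR K)%R -> abel_sum lambda K (taylor_term a s 0) (lerch s).
Proof.
  revert K. apply (proj2_sig (constructive_indefinite_description _ (abel_sum_taylor_all s))).
Qed.

(** The bound 4 instead of 3 keeps the same [K] admissible at every [s] with |s - s0| < 1. The
    differenced coefficients are bounded uniformly in [j], so |s - s0|^n is a summable majorant in
    [n]. *)
Lemma lerch_power_series (s0 : C) (K : nat) :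
  (4 <= Re s0 + INR K)%R ->
  exists c : nat -> C, (forall j, abel_sum lambda K (taylor_term a s0 j) (c j)) /\
    forall s, (Cmod (s - s0) < 1)%R -> Cseries (fun n => c n * (s - s0) ^ n) (lerch s).
Proof.
  intros HK.
  assert (Hex : forall j, exists l, abel_sum lambda K (taylor_term a s0 j) l).
  { intros j. apply abel_sum_taylor_exists. lra. }
  set (c := fun j => proj1_sig (constructive_indefinite_description _ (Hex j))).
  assert (Hc : forall j, abel_sum lambda K (taylor_term a s0 j) (c j)).
  { intros j. apply (proj2_sig (constructive_indefinite_description _ (Hex j))). }
  exists c; split; [exact Hc|]. intros s Hs.
  destruct (fdiffs_taylor_term_bound a s0 K ha) as [M HM]; [lra|].
  destruct (abel_sum_exchange lambda hlambda K
    (fun n m => (s - s0) ^ n * taylor_term a s0 n m)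
    (fun m => (M * / (INR m + Re a) ^ 2)%R) (fun n => (Cmod (s - s0) ^ n)%R)
    (taylor_term a s 0) (fun n => (s - s0) ^ n * c n)) as [l [Hl HF]].
  - intros n m. rewrite fdiffs_scal, Cmod_mult, Cmod_pow, Rmult_comm.
    apply Rmult_le_compat_r; [apply pow_le, Cmod_ge_0 | apply HM].
  - apply (ex_series_scal_l (V := R_NormedModule) M), ex_series_inv_sqr, ha.
  - apply ex_series_geom. rewrite Rabs_pos_eq; [exact Hs | apply Cmod_ge_0].
  - intros m. eapply Cseries_ext; [|apply (taylor_term_series a s0 s m)].
    intros n; cbv beta; ring.
  - intros n. now apply abel_sum_scal.
  - replace (lerch s) with l.
    + eapply Cseries_ext; [|exact Hl]. intros n; cbv beta; ring.
    + apply (abel_sum_unique lambda K (taylor_term a s 0)); [exact HF|].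
      apply lerch_abel_sum.
      assert (Rabs (Re (s - s0)) <= Cmod (s - s0))%R by apply re_le_Cmod.
      assert (Re (s - s0) = Re s - Re s0)%R by reflexivity.
      pose proof (Rle_abs (- Re (s - s0))) as H1. rewrite Rabs_Ropp in H1. lra.
Qed.

Lemma lerch_analytic : analytic lerch.
Proof.
  intros s0. destruct (INR_unbounded (4 - Re s0)) as [K HK].
  destruct (lerch_power_series s0 K) as [c [_ Hc]]; [lra|].
  exists c, 1%R. split; [lra | exact Hc].
Qed.

Lemma taylor_term_0_lim (s : C) : (0 < Re s)%R -> Clim (taylor_term a s 0) 0.
Proof.
  intros Hs.
  apply Clim_le with (e := fun m => exp (2 * Rabs (Im s) + - (Re s) * ln (INR m + Re a))%R).
  - intros m. pose proof (pos_INR m) as Hm.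
    replace (taylor_term a s 0 m - 0) with (Cexp (- s * Clog (RtoC (INR m) + a)))
      by (unfold taylor_term; simpl; field).
    rewrite Cmod_Cexp. apply exp_le. set (z := RtoC (INR m) + a).
    assert (Hre : (Re z = INR m + Re a)%R) by reflexivity.
    assert (Hz : (0 < Re z)%R) by lra.
    replace (Re (- s * Clog z)) with (Im s * Carg z + - Re s * ln (Cmod z))%R
      by (unfold Clog, Cmult, Copp, Re, Im; simpl; ring).
    apply Rplus_le_compat.
    + eapply Rle_trans; [apply Rle_abs|]. rewrite Rabs_mult.
      pose proof (Rabs_pos (Im s)). pose proof (Rabs_Carg_le z Hz). nra.
    + rewrite <- Hre.
      assert (ln (Re z) <= ln (Cmod z))%R; [|nra].
      apply ln_le; [exact Hz|].
      eapply Rle_trans; [apply Rle_abs | apply re_le_Cmod].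
  - apply (is_lim_comp_seq exp _ m_infty).
    + exact is_lim_exp_m.
    + exists 0%nat. intros n _. discriminate.
    + eapply is_lim_seq_plus with (l1 := Finite (2 * Rabs (Im s))) (l2 := m_infty);
        [apply is_lim_seq_const | | reflexivity].
      replace m_infty with (Rbar_mult (- Re s)%R p_infty).
      * apply is_lim_seq_scal_l. apply (is_lim_comp_seq ln _ p_infty).
        -- apply is_lim_ln_p.
        -- exists 0%nat. intros n _. discriminate.
        -- apply is_lim_seq_plus with (l1 := p_infty) (l2 := Re a);
             [apply is_lim_seq_INR | apply is_lim_seq_const | reflexivity].
      * simpl. destruct (Rle_dec 0 (- Re s)) as [H|H]; [exfalso; lra | reflexivity].
Qed.

(** For 0 < Re s <= 1 the series may converge only conditionally. The powers x^(-s) still tend to 0,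
    which allows the Abel steps to be undone one by one. *)
Lemma lerch_Cseries (s : C) :
  (0 < Re s)%R ->
  Cseries (fun n => lambda ^ n / Cpower (RtoC (INR n) + a) s) (lerch s).
Proof.
  intros Hs. destruct (INR_unbounded (3 - Re s)) as [K HK].
  eapply Cseries_ext; [|apply (abel_sum_Cseries lambda hlambda hlambda1 K _ _
    (taylor_term_0_lim s Hs)), lerch_abel_sum; lra].
  intros n. cbv beta. unfold taylor_term, Cpower.
  replace (- s * Clog (RtoC (INR n) + a)) with (- (s * Clog (RtoC (INR n) + a))) by ring.
  rewrite Cexp_opp. unfold Cdiv. simpl.
  replace (/ RtoC 1) with (RtoC 1) by (field). ring.
Qed.

Lemma lerch_continuation_lerch : lerch_continuation lambda a lerch.
Proof. split; [apply lerch_analytic | apply lerch_Cseries]. Qed.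

(** [lerch] witnesses that a continuation exists, so [epsilon] returns one; both have the same
    series for Re s > 0, and the identity theorem does the rest. *)
Lemma Phi_lerch (s : C) : Phi lambda s a = lerch s.
Proof.
  unfold Phi. set (F := epsilon _ (lerch_continuation lambda a)).
  assert (HF : lerch_continuation lambda a F).
  { apply epsilon_spec. exists lerch. apply lerch_continuation_lerch. }
  apply analytic_unique; [apply HF | apply lerch_analytic|].
  intros z Hz. eapply Cseries_unique; [apply (proj2 HF z Hz) | now apply lerch_Cseries].
Qed.

Lemma Phi_abel_sum (s : C) (K : nat) :
  (3 <= Re s + INR K)%R ->
  abel_sum lambda K (fun m => Cexp (- s * Clog (RtoC (INR m) + a))) (Phi lambda s a).
Proof.
  intros HK. rewrite Phi_lerch.
  eapply abel_sum_ext; [|now apply lerch_abel_sum].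
  intros m. unfold taylor_term. simpl. field.
Qed.

Lemma dPhi_abel_sum (s : C) (K : nat) :
  (4 <= Re s + INR K)%R ->
  abel_sum lambda K
    (fun m => - Clog (RtoC (INR m) + a) * Cexp (- s * Clog (RtoC (INR m) + a)))
    (dPhi lambda s a).
Proof.
  intros HK. destruct (lerch_power_series s K HK) as [c [Hc1 Hc2]].
  replace (dPhi lambda s a) with (c 1%nat).
  - eapply abel_sum_ext; [|apply (Hc1 1%nat)].
    intros m. unfold taylor_term. simpl. field.
  - symmetry. unfold dPhi. apply (C_derive_power_series _ s c 1); [lra|].
    intros z Hz. rewrite Phi_lerch. now apply Hc2.
Qed.

End Continuation.

(** * The digamma function at positive integers *)

Open Scope R_scope.

(** * Improper integrals over the positive half-line and Euler's integral *)

Notation is_RInt_0_oo f l := (is_RInt_gen f (at_right 0) (Rbar_locally p_infty) l).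

Definition gamma_integrand (x u : R) : R := Rpower u (x - 1) * exp (- u).

Lemma at_right_0_pos (c : R) : 0 < c -> at_right 0 (fun a => 0 < a < c).
Proof.
  intros Hc. exists (mkposreal c Hc). intros y Hy Hy0.
  split; [exact Hy0|]. apply Rabs_lt_between' in Hy. simpl in Hy. lra.
Qed.

Lemma filter_prod_0_oo (P : R * R -> Prop) (a0 b0 : R) :
  0 < a0 -> (forall a b, 0 < a < a0 -> b0 < b -> P (a, b)) ->
  filter_prod (at_right 0) (Rbar_locally p_infty) P.
Proof.
  intros Ha0 H. apply Filter_prod with (Q := fun a => 0 < a < a0) (R := fun b => b0 < b).
  - now apply at_right_0_pos.
  - now exists b0.
  - exact H.
Qed.

Lemma is_RInt_0_oo_pos (f : R -> R) (l : R) :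
  (forall u, 0 < u -> 0 <= f u) -> is_RInt_0_oo f l -> 0 <= l.
Proof.
  intros Hf Hl.
  (* The zero function, written as a multiple of [f] so that its integral is at hand, is dominated
     in norm by [f]; the norm inequality for integrals then reads 0 <= l. *)
  assert (H0 : is_RInt_0_oo (fun _ => scal 0 (f 0)) (scal 0 l)).
  { eapply is_RInt_gen_ext; [|apply (is_RInt_gen_scal f 0 l Hl)].
    apply filter_forall. intros ab x _. unfold scal; simpl; unfold mult; simpl. ring. }
  replace 0 with (norm (scal 0 l))
    by (unfold scal, norm; simpl; unfold mult, abs; simpl; rewrite Rmult_0_l; apply Rabs_R0).
  refine (RInt_gen_norm (V := R_CompleteNormedModule) _ f _ _ _ _ H0 Hl).
  - apply filter_prod_0_oo with 1 1; [lra|]. intros a b Ha Hb; simpl; lra.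
  - apply filter_prod_0_oo with 1 1; [lra|]. intros a b Ha Hb x Hx; simpl in Hx.
    unfold scal, norm; simpl; unfold mult, abs; simpl. rewrite Rmult_0_l, Rabs_R0.
    apply Hf. lra.
Qed.

(** For a nonnegative integrand the integrals over [a, b] grow with the interval, and the
    exponential bounds them by 2c; their supremum is the improper integral. *)
Lemma ex_RInt_0_oo_of_exp_bound (f : R -> R) (c : R) :
  (forall u, 0 < u -> continuous f u) ->
  (forall u, 0 < u -> 0 <= f u <= c * exp (- u / 2)) ->
  ex_RInt_gen f (at_right 0) (Rbar_locally p_infty).
Proof.
  intros Hcont Hf.
  assert (Hex : forall a b, 0 < a -> 0 < b -> ex_RInt f a b).
  { intros a b Ha Hb. apply (ex_RInt_continuous (V := R_CompleteNormedModule)).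
    intros z Hz. apply Hcont. eapply Rlt_le_trans; [|apply Hz]. now apply Rmin_glb_lt. }
  assert (Hc : 0 <= c).
  { specialize (Hf 1 Rlt_0_1). pose proof (exp_pos (- (1) / 2)).
    apply (Rmult_le_reg_r (exp (- (1) / 2))); lra. }
  assert (Hbound : forall a b, 0 < a <= b -> RInt f a b <= 2 * c).
  { intros a b Hab.
    assert (Hi : is_RInt (fun u => c * exp (- u / 2)) a b
                   (- 2 * c * exp (- b / 2) - (- 2 * c * exp (- a / 2)))).
    { apply (is_RInt_derive (V := R_CompleteNormedModule) (fun u => - 2 * c * exp (- u / 2))).
      - intros x _. auto_derive; [auto | unfold Rdiv; field].
      - intros x _. apply (ex_derive_continuous (V := R_NormedModule)). auto_derive. auto. }
    apply Rle_trans with (RInt (fun u => c * exp (- u / 2)) a b).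
    - apply RInt_le; [lra | apply Hex; lra | eexists; exact Hi |].
      intros x Hx. apply Hf. lra.
    - rewrite (is_RInt_unique _ _ _ _ Hi).
      assert (exp (- a / 2) <= 1).
      { rewrite <- exp_0. left. apply exp_increasing. lra. }
      pose proof (exp_pos (- b / 2)). nra. }
  destruct (completeness (fun v => exists a b, 0 < a <= b /\ v = RInt f a b))
    as [l [Hub Hleast]].
  { exists (2 * c). intros v [a [b [Hab ->]]]. now apply Hbound. }
  { exists (RInt f 1 1), 1, 1. split; [lra | reflexivity]. }
  exists l. intros P [eps HP].
  destruct (classic (exists a b, 0 < a <= b /\ l - eps < RInt f a b)) as [[a [b [Hab Hl]]] | Hno].
  - apply filter_prod_0_oo with a b; [lra|].
    intros a' b' Ha' Hb'. exists (RInt f a' b'); split.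
    + apply (RInt_correct (V := R_CompleteNormedModule)), Hex; simpl; lra.
    + apply HP. apply Rabs_lt_between'.
      assert (Hup : RInt f a' b' <= l) by (apply Hub; exists a', b'; split; [lra | reflexivity]).
      assert (Hsplit : RInt f a' b' = RInt f a' a + RInt f a b + RInt f b b').
      { rewrite <- (RInt_Chasles f a' b b') by (apply Hex; lra).
        rewrite <- (RInt_Chasles f a' a b) by (apply Hex; lra). reflexivity. }
      assert (0 <= RInt f a' a).
      { apply RInt_ge_0; [lra | apply Hex; lra | intros x Hx; apply Hf; lra]. }
      assert (0 <= RInt f b b').
      { apply RInt_ge_0; [lra | apply Hex; lra | intros x Hx; apply Hf; lra]. }
      destruct eps as [e He]; simpl in *. lra.
  - exfalso. assert (l <= l - eps).
    { apply Hleast. intros v [a [b [Hab ->]]].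
      destruct (Rle_dec (RInt f a b) (l - eps)) as [|Hn]; [assumption|].
      exfalso. apply Hno. exists a, b. split; [exact Hab | lra]. }
    destruct eps as [e He]; simpl in *. lra.
Qed.

Lemma Rpower_exp_bound (y : R) :
  0 <= y -> exists c, forall u, 0 < u -> Rpower u y * exp (- u) <= c * exp (- u / 2).
Proof.
  (* The inequality ln v <= v is used at v = u / (2 (y + 1)), scaled so that y v <= u / 2; the rest
     of y ln u is the logarithm of the witness. *)
  intros Hy. exists (exp (y * ln (2 * (y + 1)))). intros u Hu.
  unfold Rpower. rewrite <- !exp_plus.
  assert (Hln : ln u <= u / (2 * (y + 1)) + ln (2 * (y + 1))).
  { set (v := u / (2 * (y + 1))).
    assert (Hv : 0 < v) by (apply Rdiv_lt_0_compat; lra).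
    replace u with (v * (2 * (y + 1))) at 1 by (unfold v; field; lra).
    rewrite ln_mult by lra.
    assert (ln v <= v); [|lra].
    left. rewrite <- (ln_exp v) at 2. apply ln_increasing; [exact Hv|].
    pose proof (exp_ineq1 v). lra. }
  assert (H : y * ln u + - u <= y * ln (2 * (y + 1)) + - u / 2).
  { assert (y * ln u <= y * (u / (2 * (y + 1)) + ln (2 * (y + 1)))) by nra.
    assert (y * (u / (2 * (y + 1))) <= u / 2); [|lra].
    replace (u / 2) with ((y + 1) * (u / (2 * (y + 1)))) by (field; lra).
    apply Rmult_le_compat_r; [|lra]. left. apply Rdiv_lt_0_compat; lra. }
  destruct H as [H | ->]; [left; now apply exp_increasing | lra].
Qed.

Lemma is_derive_Rpower (u y : R) :
  0 < u -> is_derive (fun v => Rpower v y) u (y * Rpower u (y - 1)).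
Proof.
  intros Hu. apply is_derive_Reals. now apply derivable_pt_lim_power.
Qed.

(** For 1 <= x the factor u^(x-1) stays bounded near 0, so one exponential majorant covers both
    ends. *)
Lemma Gamma_correct (x : R) :
  1 <= x -> is_RInt_0_oo (gamma_integrand x) (Gamma x).
Proof.
  intros Hx. apply (RInt_gen_correct (V := R_CompleteNormedModule)); try typeclasses eauto.
  destruct (Rpower_exp_bound (x - 1)) as [c Hc]; [lra|].
  apply ex_RInt_0_oo_of_exp_bound with c.
  - intros u Hu. apply (ex_derive_continuous (V := R_NormedModule)).
    apply ex_derive_mult.
    + eexists. now apply is_derive_Rpower.
    + auto_derive. auto.
  - intros u Hu. split; [|now apply Hc].
    left. apply Rmult_lt_0_compat; apply exp_pos.
Qed.

Lemma is_RInt_0_oo_derive (F f : R -> R) (la lb : R) :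
  (forall u, 0 < u -> is_derive F u (f u)) -> (forall u, 0 < u -> continuous f u) ->
  filterlim F (at_right 0) (locally la) ->
  filterlim F (Rbar_locally p_infty) (locally lb) ->
  is_RInt_0_oo f (lb - la).
Proof.
  intros Hd Hc Ha Hb.
  apply (is_RInt_gen_ext (V := R_NormedModule) (Derive F)).
  - apply filter_prod_0_oo with 1 1; [lra|]. intros a b Hab Hb' x Hx. simpl in Hx.
    rewrite Rmin_left in Hx by lra. apply is_derive_unique, Hd. lra.
  - apply is_RInt_gen_Derive; [| |exact Ha | exact Hb].
    + apply filter_prod_0_oo with 1 1; [lra|]. intros a b Hab Hb' x Hx. simpl in Hx.
      rewrite Rmin_left in Hx by lra. eexists. apply Hd. lra.
    + apply filter_prod_0_oo with 1 1; [lra|]. intros a b Hab Hb' x Hx. simpl in Hx.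
      rewrite Rmin_left in Hx by lra. assert (Hx0 : 0 < x) by lra.
      apply (continuous_ext_loc (Derive F) f).
      * exists (mkposreal x Hx0). intros z Hz. apply Rabs_lt_between' in Hz. simpl in Hz.
        symmetry. apply is_derive_unique, Hd. lra.
      * now apply Hc.
Qed.

Lemma filterlim_neg_exp_oo : filterlim (fun u => - exp (- u)) (Rbar_locally p_infty) (locally 0).
Proof.
  change (is_lim (fun u => - exp (- u)) p_infty 0).
  replace (Finite 0) with (Rbar_opp 0) by (simpl; f_equal; ring).
  apply is_lim_opp. apply (is_lim_comp exp (fun u => - u) p_infty 0 m_infty).
  - exact is_lim_exp_m.
  - apply (is_lim_opp (fun u => u) p_infty p_infty), is_lim_id.
  - exists 0. intros; discriminate.
Qed.

Lemma Gamma_1 : Gamma 1 = 1.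
Proof.
  assert (H : is_RInt_0_oo (gamma_integrand 1) (0 - - (1))); [|
    replace (0 - - (1)) with 1 in H by ring;
    exact (is_RInt_gen_unique (V := R_CompleteNormedModule) _ _ H)].
  unfold gamma_integrand.
  apply is_RInt_0_oo_derive with (F := fun u => - exp (- u)).
  - intros u Hu. replace (Rpower u (1 - 1)) with 1.
    + auto_derive; [auto | ring].
    + unfold Rpower. replace ((1 - 1) * ln u) with 0 by ring. now rewrite exp_0.
  - intros u Hu. apply (continuous_ext (fun v => exp (- v))).
    + intros v. unfold Rpower. replace ((1 - 1) * ln v) with 0 by ring. rewrite exp_0. symmetry. apply Rmult_1_l.
    + apply (ex_derive_continuous (V := R_NormedModule)). auto_derive. auto.
  - replace (- (1)) with (- exp (- 0)) by (rewrite Ropp_0, exp_0; ring).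
    eapply filterlim_filter_le_1; [apply filter_le_within|].
    apply (ex_derive_continuous (V := R_NormedModule) (fun u => - exp (- u)) 0). auto_derive. auto.
  - apply filterlim_neg_exp_oo.
Qed.

(** The difference of the two integrands is the exact derivative of -u^x e^(-u), which vanishes at
    both ends. *)
Lemma Gamma_succ (x : R) : 1 <= x -> Gamma (x + 1) = x * Gamma x.
Proof.
  intros Hx.
  set (F := fun u => - (Rpower u x * exp (- u))).
  assert (H : is_RInt_0_oo (fun u => gamma_integrand (x + 1) u - x * gamma_integrand x u) (0 - 0)).
  { apply is_RInt_0_oo_derive with (F := F).
    - intros u Hu. unfold F, gamma_integrand.
      replace (Rpower u (x + 1 - 1) * exp (- u) - x * (Rpower u (x - 1) * exp (- u))) with
        (- (x * Rpower u (x - 1) * exp (- u) + Rpower u x * (- exp (- u))))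
        by (replace (x + 1 - 1) with x by ring; ring).
      apply (is_derive_opp (fun u => Rpower u x * exp (- u))).
      apply (is_derive_mult (fun u => Rpower u x) (fun u => exp (- u)));
        [now apply is_derive_Rpower | auto_derive; [auto | ring] | intros; apply Rmult_comm].
    - intros u Hu. apply (ex_derive_continuous (V := R_NormedModule)).
      unfold gamma_integrand. apply (ex_derive_minus (V := R_NormedModule)).
      + apply ex_derive_mult; [eexists; now apply is_derive_Rpower | auto_derive; auto].
      + apply (ex_derive_scal (fun u => Rpower u (x - 1) * exp (- u))).
        apply ex_derive_mult; [eexists; now apply is_derive_Rpower | auto_derive; auto].
    - apply filterlim_locally. intros eps.
      assert (Hm : 0 < Rmin 1 eps) by (apply Rmin_glb_lt; [lra | apply cond_pos]).
      generalize (at_right_0_pos _ Hm). apply filter_imp. intros u [Hu0 Hu].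
      pose proof (Rmin_l 1 eps). pose proof (Rmin_r 1 eps).
      assert (Hp : Rpower u x <= u).
      { unfold Rpower. rewrite <- (exp_ln u) at 2 by exact Hu0.
        assert (ln u <= 0) by (rewrite <- ln_1; apply ln_le; lra).
        assert (Hle : x * ln u <= ln u) by nra.
        destruct Hle as [Hlt | ->]; [left; now apply exp_increasing | lra]. }
      assert (He : exp (- u) <= 1).
      { rewrite <- exp_0. left. apply exp_increasing. lra. }
      pose proof (exp_pos (- u)). assert (0 < Rpower u x) by apply exp_pos.
      apply Rabs_lt_between'. unfold F. split; nra.
    - destruct (Rpower_exp_bound x) as [c Hc]; [lra|].
      assert (Hlim : is_lim (fun u => - c * exp (- u / 2)) p_infty 0).
      { replace (Finite 0) with (Rbar_mult (- c) 0) by (simpl; f_equal; ring).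
        apply is_lim_scal_l. apply (is_lim_comp exp (fun u => - u / 2) p_infty 0 m_infty).
        - exact is_lim_exp_m.
        - apply (is_lim_ext (fun u => - / 2 * u)); [intros u; field|].
          replace m_infty with (Rbar_mult (- / 2) p_infty).
          + apply is_lim_scal_l, is_lim_id.
          + simpl. destruct (Rle_dec 0 (- / 2)) as [Hn|Hn]; [exfalso; lra | reflexivity].
        - exists 0. intros; discriminate. }
      apply (is_lim_le_le_loc (fun u => - c * exp (- u / 2)) (fun _ => 0) F p_infty 0).
      + exists 0. intros u Hu. specialize (Hc u Hu). unfold F.
        assert (0 < Rpower u x) by apply exp_pos. pose proof (exp_pos (- u)). split; nra.
      + exact Hlim.
      + apply is_lim_const. }
  assert (H' : is_RInt_0_oo (fun u => gamma_integrand (x + 1) u - x * gamma_integrand x u)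
                 (Gamma (x + 1) - x * Gamma x)).
  { apply (is_RInt_gen_minus (V := R_NormedModule));
      [|apply (is_RInt_gen_scal (V := R_NormedModule))]; apply Gamma_correct; lra. }
  apply (is_RInt_gen_unique (V := R_CompleteNormedModule)) in H, H'.
  rewrite H in H'. lra.
Qed.

(** Convexity of the exponent-to-power map k -> u^k, as a comparison of slopes from 0. The tangent
    of [exp] at [h * l] lies below its values at [k * l] and 0; with weights [h] and [k - h] the
    linear terms cancel. *)
Lemma Rpower_chord (u h k : R) :
  0 < h < k -> 0 <= h * Rpower u k - k * Rpower u h + (k - h).
Proof.
  intros Hhk. unfold Rpower. set (l := ln u).
  assert (Ht : forall v w, exp w * (1 + (v - w)) <= exp v).
  { intros v w. replace v with (w + (v - w)) at 2 by ring. rewrite exp_plus.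
    apply Rmult_le_compat_l; [left; apply exp_pos|].
    destruct (Req_dec (v - w) 0) as [->|Hne]; [rewrite exp_0; lra|].
    left. now apply exp_ineq1. }
  pose proof (Ht (k * l) (h * l)) as H1. pose proof (Ht 0 (h * l)) as H2.
  rewrite exp_0 in H2. pose proof (exp_pos (h * l)).
  assert (h * (exp (h * l) * (1 + (k * l - h * l))) <= h * exp (k * l)) by nra.
  assert ((k - h) * (exp (h * l) * (1 + (0 - h * l))) <= (k - h) * 1) by nra.
  nra.
Qed.

Lemma Gamma_chord (x h k : R) :
  1 <= x -> 0 < h < k ->
  (Gamma (x + h) - Gamma x) / h <= (Gamma (x + k) - Gamma x) / k.
Proof.
  intros Hx Hhk.
  assert (H : 0 <= (h * Gamma (x + k) - k * Gamma (x + h)) + (k - h) * Gamma x).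
  { apply (is_RInt_0_oo_pos (fun u => (h * gamma_integrand (x + k) u
      - k * gamma_integrand (x + h) u) + (k - h) * gamma_integrand x u)).
    - intros u Hu. unfold gamma_integrand.
      replace (x + k - 1) with ((x - 1) + k) by ring.
      replace (x + h - 1) with ((x - 1) + h) by ring. rewrite !Rpower_plus.
      replace (_ + _) with (Rpower u (x - 1) * exp (- u) *
        (h * Rpower u k - k * Rpower u h + (k - h))) by ring.
      apply Rmult_le_pos; [|now apply Rpower_chord].
      left. apply Rmult_lt_0_compat; apply exp_pos.
    - apply (is_RInt_gen_plus (V := R_NormedModule));
        [apply (is_RInt_gen_minus (V := R_NormedModule))|];
        apply (is_RInt_gen_scal (V := R_NormedModule)); apply Gamma_correct; lra. }
  apply (Rmult_le_reg_r (h * k)); [nra|].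
  replace ((Gamma (x + h) - Gamma x) / h * (h * k)) with (k * (Gamma (x + h) - Gamma x))
    by (field; lra).
  replace ((Gamma (x + k) - Gamma x) / k * (h * k)) with (h * (Gamma (x + k) - Gamma x))
    by (field; lra).
  lra.
Qed.

(** From u^h - 1 >= h ln u and u ln u >= u - 1, multiplied by powers of u and integrated. The
    integral at [x - 1] explains the start at 2. *)
Lemma Gamma_quotient_lower (x h : R) :
  2 <= x -> 0 < h -> Gamma x - Gamma (x - 1) <= (Gamma (x + h) - Gamma x) / h.
Proof.
  intros Hx Hh.
  assert (H : 0 <= ((Gamma (x + h) - Gamma x) - h * Gamma x) + h * Gamma (x - 1)).
  { apply (is_RInt_0_oo_pos (fun u => ((gamma_integrand (x + h) u - gamma_integrand x u)
      - h * gamma_integrand x u) + h * gamma_integrand (x - 1) u)).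
    - intros u Hu. unfold gamma_integrand.
      replace (x + h - 1) with ((x - 1 - 1) + (1 + h)) by ring.
      replace (x - 1) with ((x - 1 - 1) + 1) at 2 3 by ring.
      rewrite !Rpower_plus, !Rpower_1 by exact Hu.
      replace (_ + _) with (Rpower u (x - 1 - 1) * exp (- u) *
        (u * Rpower u h - u - h * u + h)) by ring.
      apply Rmult_le_pos; [left; apply Rmult_lt_0_compat; apply exp_pos|].
      assert (Hl : 1 + h * ln u <= Rpower u h).
      { unfold Rpower. destruct (Req_dec (h * ln u) 0) as [->|Hne]; [rewrite exp_0; lra|].
        left. now apply exp_ineq1. }
      assert (Hln : u - 1 <= u * ln u).
      { assert (Hi : ln (/ u) <= / u - 1).
        { assert (Hu' : 0 < / u) by now apply Rinv_0_lt_compat.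
          destruct (Req_dec (ln (/ u)) 0) as [E|Hne].
          - rewrite E. rewrite <- (exp_ln (/ u)), E, exp_0 by exact Hu'. lra.
          - pose proof (exp_ineq1 _ Hne). rewrite exp_ln in H by exact Hu'. lra. }
        rewrite ln_Rinv in Hi by exact Hu.
        apply (Rmult_le_compat_l u) in Hi; [|lra].
        rewrite Rmult_minus_distr_l, Rinv_r in Hi by lra. lra. }
      nra.
    - apply (is_RInt_gen_plus (V := R_NormedModule));
        [apply (is_RInt_gen_minus (V := R_NormedModule));
         [apply (is_RInt_gen_minus (V := R_NormedModule)) |
          apply (is_RInt_gen_scal (V := R_NormedModule))] |
         apply (is_RInt_gen_scal (V := R_NormedModule))];
        apply Gamma_correct; lra. }
  apply (Rmult_le_reg_r h); [exact Hh|].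
  replace ((Gamma (x + h) - Gamma x) / h * h) with (Gamma (x + h) - Gamma x) by (field; lra).
  lra.
Qed.

(** The leading [0 +] keeps this convertible with the sequence through which [Lim] at 0 is
    defined. *)
Definition step (n : nat) : R := 0 + / (INR n + 1).

Lemma step_pos (n : nat) : 0 < step n.
Proof.
  unfold step. rewrite Rplus_0_l. apply Rinv_0_lt_compat. pose proof (pos_INR n). lra.
Qed.

Lemma step_lim : is_lim_seq step 0.
Proof. apply (is_lim_seq_Rbar_loc_seq 0). Qed.

(* [Derive Gamma x] unfolds to the limit of the difference quotients along
   [step], so only right derivatives matter; they exist by convexity. *)
Lemma Gamma_Derive_lim (x : R) :
  1 <= x -> is_lim_seq (fun n => (Gamma (x + step n) - Gamma x) / step n) (Derive Gamma x).
Proof.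
  intros Hx. set (q := fun x n => (Gamma (x + step n) - Gamma x) / step n).
  assert (Hq2 : forall x, 2 <= x -> exists l : R, is_lim_seq (q x) l).
  { intros y Hy. apply (ex_finite_lim_seq_decr (q y) (Gamma y - Gamma (y - 1))).
    - intros n. apply Gamma_chord; [lra|]. split; [apply step_pos|].
      unfold step. rewrite !Rplus_0_l, S_INR. pose proof (pos_INR n).
      apply Rinv_lt_contravar; nra.
    - intros n. apply Gamma_quotient_lower; [exact Hy | apply step_pos]. }
  (* The lower bound is available only from 2 on; the functional equation carries the limit from
     [x + 1] back to [x]. *)
  destruct (Hq2 (x + 1)) as [l Hl]; [lra|].
  assert (Hq : is_lim_seq (q x) ((l - Gamma x) / (x + 0))).
  { apply is_lim_seq_ext with (u := fun n => (q (x + 1) n - Gamma x) / (x + step n)).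
    - intros n. unfold q. pose proof (step_pos n).
      replace (x + 1 + step n) with ((x + step n) + 1) by ring.
      rewrite !Gamma_succ by lra. field. lra.
    - apply is_lim_seq_div'; [|apply is_lim_seq_plus' | lra].
      + apply is_lim_seq_minus'; [exact Hl | apply is_lim_seq_const].
      + apply is_lim_seq_const.
      + apply step_lim. }
  replace (Derive Gamma x) with ((l - Gamma x) / (x + 0)); [exact Hq|].
  unfold Derive, Lim. symmetry. exact (f_equal real (is_lim_seq_unique _ _ Hq)).
Qed.

(** The product rule for x Gamma(x), carried out on the difference quotients along [step], where the
    limit is known to exist. *)
Lemma Derive_Gamma_succ (x : R) :
  1 <= x -> Derive Gamma (x + 1) = Gamma x + x * Derive Gamma x.
Proof.
  intros Hx. pose proof (Gamma_Derive_lim x Hx) as H.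
  assert (H1 : is_lim_seq (fun n => (Gamma (x + 1 + step n) - Gamma (x + 1)) / step n)
                 (Gamma x + (x + 0) * Derive Gamma x)).
  { apply is_lim_seq_ext with
      (u := fun n => Gamma x + (x + step n) * ((Gamma (x + step n) - Gamma x) / step n)).
    - intros n. pose proof (step_pos n).
      replace (x + 1 + step n) with ((x + step n) + 1) by ring.
      rewrite !Gamma_succ by lra. field. lra.
    - apply is_lim_seq_plus'; [apply is_lim_seq_const|].
      apply is_lim_seq_mult'; [|exact H].
      apply is_lim_seq_plus'; [apply is_lim_seq_const | apply step_lim]. }
  apply is_lim_seq_unique in H1.
  pose proof (is_lim_seq_unique _ _ (Gamma_Derive_lim (x + 1) ltac:(lra))) as H2.
  rewrite H1 in H2. injection H2. intros E. rewrite <- E. ring.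
Qed.

Fixpoint harmonic (n : nat) : R :=
  match n with O => 0 | S n' => harmonic n' + / INR (S n') end.

Lemma Gamma_INR_neq_0 (n : nat) : Gamma (INR n + 1) <> 0.
Proof.
  induction n as [|n IH].
  - simpl. rewrite Rplus_0_l, Gamma_1. lra.
  - rewrite S_INR, Gamma_succ by (pose proof (pos_INR n); lra).
    apply Rmult_integral_contrapositive_currified; [|exact IH].
    pose proof (pos_INR n). lra.
Qed.

Lemma digamma_INR (n : nat) : digamma (INR n + 1) = digamma 1 + harmonic n.
Proof.
  induction n as [|n IH].
  - simpl. rewrite Rplus_0_l. ring.
  - change (harmonic (S n)) with (harmonic n + / INR (S n)).
    rewrite <- Rplus_assoc, <- IH. pose proof (pos_INR n).
    unfold digamma. rewrite S_INR, (Derive_Gamma_succ (INR n + 1)), (Gamma_succ (INR n + 1)) by lra.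
    field. split; [lra | apply Gamma_INR_neq_0].
Qed.

Open Scope C_scope.

(** * The termwise identity *)

(** Kept general in [g], because the same split drives the inductions for the binomial theorem and
    for the harmonic sum. *)
Lemma Csum_pascal (g : nat -> C) (q : nat) :
  Csum (fun k => RtoC (Binomial.C (S q) k) * g k) (S q) =
  Csum (fun k => RtoC (Binomial.C q k) * g k) q +
  Csum (fun k => RtoC (Binomial.C q k) * g (S k)) q.
Proof.
  destruct q as [|q].
  - rewrite Csum_S, !Csum_0, !C_n_0, !C_n_n. ring.
  - rewrite Csum_shift, (Csum_shift (fun k => RtoC (Binomial.C (S q) k) * g k)).
    rewrite !Csum_S, !C_n_0, !C_n_n.
    rewrite (Csum_ext _ (fun k => RtoC (Binomial.C (S q) (S k)) * g (S k)
                           + RtoC (Binomial.C (S q) k) * g (S k))).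
    + rewrite Csum_plus. ring.
    + intros k Hk. rewrite <- pascal by lia. rewrite RtoC_plus. ring.
Qed.

Lemma Cbinomial (y t : C) (q : nat) :
  Csum (fun k => RtoC (Binomial.C q k) * (y ^ k * t ^ (q - k))) q = (y + t) ^ q.
Proof.
  induction q as [|q IH].
  - rewrite Csum_0, C_n_0. simpl. ring.
  - rewrite Csum_pascal, Cpow_S, <- IH, Cmult_plus_distr_r, <- !Csum_scal, Cplus_comm.
    f_equal; apply Csum_ext; intros k Hk.
    + simpl (S q - S k)%nat. rewrite Cpow_S. ring.
    + replace (S q - k)%nat with (S (q - k)) by lia. rewrite Cpow_S. ring.
Qed.

(** The binomial theorem integrated once: C(q,k) / (k+1) = C(q+1,k+1) / (q+1), so up to the factor 1
    / (q+1) this is the sum of order q + 1 without its term t^(q+1). *)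
Lemma Cbinomial_div_succ (y t : C) (q : nat) :
  Csum (fun k => RtoC (Binomial.C q k) * (/ RtoC (INR (S k)) * (y ^ S k * t ^ (q - k)))) q =
  ((y + t) ^ S q - t ^ S q) / RtoC (INR (S q)).
Proof.
  rewrite <- Cbinomial, Csum_shift, C_n_0. simpl (S q - 0)%nat.
  replace (RtoC 1 * (y ^ 0 * t ^ S q) +
     Csum (fun k => RtoC (Binomial.C (S q) (S k)) * (y ^ S k * t ^ (S q - S k))) q - t ^ S q)
    with (Csum (fun k => RtoC (Binomial.C (S q) (S k)) * (y ^ S k * t ^ (S q - S k))) q)
    by (change (y ^ 0) with (RtoC 1); ring).
  unfold Cdiv. rewrite Cmult_comm, <- Csum_scal. apply Csum_ext. intros k Hk.
  replace (Binomial.C (S q) (S k)) with (Binomial.C q k * (INR (S q) / INR (S k)))%R.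
  - rewrite RtoC_mult, RtoC_div by (apply not_0_INR; lia). simpl (S q - S k)%nat.
    field. split; apply INR_C_neq_0.
  - unfold Binomial.C. simpl (S q - S k)%nat. rewrite !fact_simpl, !mult_INR.
    field. repeat split; try apply INR_fact_neq_0; apply not_0_INR; lia.
Qed.

(** Runs over the indices below [q] and is empty at [q = 0], whereas [Csum] includes its upper
    index. *)
Fixpoint psum (v : nat -> C) (q : nat) : C :=
  match q with O => 0 | S q' => psum v q' + v q' end.

Lemma Cseries_drop (v : nat -> C) (l : C) (q : nat) :
  Cseries v l -> Cseries (fun n => v (n + q)%nat) (l - psum v q).
Proof.
  intros H; induction q as [|q IH].
  - replace (l - psum v 0) with l by (simpl; ring).
    eapply Cseries_ext; [|exact H]. intros n; now rewrite Nat.add_0_r.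
  - simpl psum. eapply Cseries_ext with (u := fun n => v (S n + q)%nat).
    { intros n. f_equal. lia. }
    apply (Cseries_shift (fun n => v (n + q)%nat)).
    replace (v (0 + q)%nat + (l - (psum v q + v q))) with (l - psum v q) by (simpl; ring).
    exact IH.
Qed.

(** In the Pascal split, the parts with [harmonic k] add up to t + (b - t) = b times the sum of
    order q. The new reciprocals 1 / (k+1) contribute (b^(q+1) - t^(q+1)) / (q+1), which is b^(q+1)
    times the increment of the bracket on the right. *)
Lemma harmonic_binomial_sum (b t : C) (q : nat) :
  b <> 0 ->
  Csum (fun k => RtoC (Binomial.C q k) * (RtoC (harmonic k) * (b - t) ^ k * t ^ (q - k))) q =
  b ^ q * (RtoC (harmonic q) - psum (fun j => (t / b) ^ S j / RtoC (INR (S j))) q).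
Proof.
  intros Hb. induction q as [|q IH].
  - rewrite Csum_0. simpl. ring.
  - rewrite Csum_pascal.
    rewrite (Csum_ext (fun k => RtoC (Binomial.C q k) *
        (RtoC (harmonic k) * (b - t) ^ k * t ^ (S q - k)))
      (fun k => t * (RtoC (Binomial.C q k) *
        (RtoC (harmonic k) * (b - t) ^ k * t ^ (q - k))))).
    2: { intros k Hk. replace (S q - k)%nat with (S (q - k)) by lia. rewrite Cpow_S. ring. }
    rewrite (Csum_ext (fun k => RtoC (Binomial.C q k) *
        (RtoC (harmonic (S k)) * (b - t) ^ S k * t ^ (S q - S k)))
      (fun k => (b - t) * (RtoC (Binomial.C q k) *
        (RtoC (harmonic k) * (b - t) ^ k * t ^ (q - k))) +
        RtoC (Binomial.C q k) * (/ RtoC (INR (S k)) * ((b - t) ^ S k * t ^ (q - k))))).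
    2: { intros k Hk. simpl (S q - S k)%nat.
         change (harmonic (S k)) with (harmonic k + / INR (S k))%R.
         rewrite RtoC_plus, RtoC_inv by (apply not_0_INR; lia). rewrite Cpow_S. ring. }
    rewrite Csum_plus, !Csum_scal, IH, Cbinomial_div_succ.
    replace (b - t + t) with b by ring.
    change (harmonic (S q)) with (harmonic q + / INR (S q))%R.
    set (v := fun j => (t / b) ^ S j / RtoC (INR (S j))).
    change (psum v (S q)) with (psum v q + (t / b) ^ S q / RtoC (INR (S q))).
    rewrite RtoC_plus, RtoC_inv by (apply not_0_INR; lia).
    replace ((t / b) ^ S q) with (t ^ S q / b ^ S q)
      by (unfold Cdiv; rewrite Cpow_mult_l, Cpow_inv by exact Hb; reflexivity).
    rewrite !Cpow_S. field. repeat split; [now apply Cpow_nz | exact Hb | apply INR_C_neq_0].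
Qed.

(** Everything coming from digamma except the polynomial cancels: [digamma 1] is constant in [k], so
    the binomial theorem turns it into a multiple of b^q, and [harmonic q] comes out of the harmonic
    sum; the subtracted term removes both. *)
Lemma log_remainder_closed_form (b t : C) (q : nat) :
  b <> 0 ->
  Csum (fun k => RtoC (Binomial.C q k)
          * (- Clog (b - t) * (b - t) ^ k
             + RtoC (digamma (INR k + 1)) * (b - t) ^ k)
          * t ^ (q - k)) q
  - (- Clog b * b ^ q + RtoC (digamma (INR q + 1)) * b ^ q) =
  b ^ q * (Clog b - Clog (b - t) - psum (fun j => (t / b) ^ S j / RtoC (INR (S j))) q).
Proof.
  intros Hb.
  rewrite (Csum_ext _ (fun k =>
     (RtoC (digamma 1) - Clog (b - t)) *
       (RtoC (Binomial.C q k) * ((b - t) ^ k * t ^ (q - k))) +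
     RtoC (Binomial.C q k) * (RtoC (harmonic k) * (b - t) ^ k * t ^ (q - k)))).
  2: { intros k Hk. rewrite digamma_INR, RtoC_plus. ring. }
  rewrite Csum_plus, Csum_scal, Cbinomial, harmonic_binomial_sum by exact Hb.
  replace (b - t + t) with b by ring.
  rewrite digamma_INR, RtoC_plus. ring.
Qed.

(** The logarithmic series is stripped of its first [q] terms and multiplied by b^q; the remaining
    power b^(-n-1) is the summand of [Phi] at s = n + 1. *)
Lemma log_remainder_series (b t : C) (q : nat) :
  (Cmod t < Re b)%R ->
  Cseries (fun n => (/ b) ^ S n * (t ^ (n + S q) / RtoC (INR (n + S q))))
    (b ^ q * (Clog b - Clog (b - t) - psum (fun j => (t / b) ^ S j / RtoC (INR (S j))) q)).
Proof.
  intros Ht. assert (Hb : b <> 0).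
  { apply Re_gt_0_neq_0. pose proof (Cmod_ge_0 t). lra. }
  eapply Cseries_ext; [|apply Cseries_scal, (Cseries_drop _ _ q (Clog_series b t Ht))].
  intros n. cbv beta. replace (n + S q)%nat with (S (n + q)) by lia.
  unfold Cdiv. rewrite (Cpow_mult_l t (/ b)).
  replace ((/ b) ^ S (n + q)) with ((/ b) ^ S n * (/ b) ^ q)
    by (rewrite <- Cpow_add_r; f_equal; lia).
  replace (b ^ q * (t ^ S (n + q) * ((/ b) ^ S n * (/ b) ^ q) * / RtoC (INR (S (n + q))))) with
    ((b ^ q * (/ b) ^ q) * ((/ b) ^ S n * (t ^ S (n + q) * / RtoC (INR (S (n + q)))))) by ring.
  rewrite <- Cpow_mult_l, Cinv_r, Cpow_1_l by exact Hb. ring.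
Qed.

(** * From the terms in m to the values of Phi and its derivative *)

Lemma Cexp_INR_Clog (k : nat) (z : C) :
  (0 < Re z)%R -> Cexp (RtoC (INR k) * Clog z) = z ^ k.
Proof. intros Hz. now rewrite Cexp_INR, Cexp_Clog. Qed.

Lemma Cexp_opp_INR_Clog (k : nat) (z : C) :
  (0 < Re z)%R -> Cexp (- RtoC (INR k) * Clog z) = (/ z) ^ k.
Proof.
  intros Hz.
  replace (- RtoC (INR k) * Clog z) with (- (RtoC (INR k) * Clog z)) by ring.
  rewrite Cexp_opp, Cexp_INR_Clog by exact Hz.
  symmetry. apply Cpow_inv, Re_gt_0_neq_0, Hz.
Qed.

Lemma Phi_succ_abel_sum (lambda a : C) (n K : nat) :
  (Cmod lambda <= 1)%R -> lambda <> RtoC 1 -> (0 < Re a)%R -> (2 <= INR K)%R ->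
  abel_sum lambda K (fun m => (/ (RtoC (INR m) + a)) ^ S n)
    (Phi lambda (RtoC (INR n) + 1) a).
Proof.
  intros hl hl1 ha HK. eapply abel_sum_ext; [|apply Phi_abel_sum; try assumption].
  - intros m. cbv beta. pose proof (pos_INR m).
    replace (- (RtoC (INR n) + 1)) with (- RtoC (INR (S n)))
      by (rewrite S_INR, RtoC_plus; ring).
    apply Cexp_opp_INR_Clog. unfold Re in *; simpl in *; lra.
  - pose proof (pos_INR n). unfold Re; simpl. lra.
Qed.

Lemma Phi_opp_abel_sum (lambda a : C) (k K : nat) :
  (Cmod lambda <= 1)%R -> lambda <> RtoC 1 -> (0 < Re a)%R -> (4 + INR k <= INR K)%R ->
  abel_sum lambda K (fun m => (RtoC (INR m) + a) ^ k) (Phi lambda (- RtoC (INR k)) a).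
Proof.
  intros hl hl1 ha HK. eapply abel_sum_ext; [|apply Phi_abel_sum; try assumption].
  - intros m. cbv beta. pose proof (pos_INR m).
    replace (- - RtoC (INR k)) with (RtoC (INR k)) by ring.
    apply Cexp_INR_Clog. unfold Re in *; simpl in *; lra.
  - unfold Re; simpl. lra.
Qed.

Lemma dPhi_opp_abel_sum (lambda a : C) (k K : nat) :
  (Cmod lambda <= 1)%R -> lambda <> RtoC 1 -> (0 < Re a)%R -> (4 + INR k <= INR K)%R ->
  abel_sum lambda K (fun m => - Clog (RtoC (INR m) + a) * (RtoC (INR m) + a) ^ k)
    (dPhi lambda (- RtoC (INR k)) a).
Proof.
  intros hl hl1 ha HK. eapply abel_sum_ext; [|apply dPhi_abel_sum; try assumption].
  - intros m. cbv beta. pose proof (pos_INR m).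
    replace (- - RtoC (INR k)) with (RtoC (INR k)) by ring.
    rewrite Cexp_INR_Clog; [reflexivity|]. unfold Re in *; simpl in *; lra.
  - unfold Re; simpl. lra.
Qed.

Lemma Cminus_alt (x y : C) : x - y = x + - (1) * y.
Proof. ring. Qed.

Lemma Phi_sum_digamma (lambda a t : C) (q : nat) :
  (Cmod lambda <= 1)%R -> lambda <> RtoC 1 -> (0 < Re a)%R -> (Cmod t < Re a)%R ->
  Cseries
    (fun n : nat =>
       Phi lambda (RtoC (INR n) + 1) a * (t ^ (n + S q) / RtoC (INR (n + S q))))
    (Csum
       (fun k : nat =>
          RtoC (Binomial.C q k)
          * (dPhi lambda (- RtoC (INR k)) (a - t)
             + RtoC (digamma (INR k + 1)) * Phi lambda (- RtoC (INR k)) (a - t))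
          * t ^ (q - k)) q
     - (dPhi lambda (- RtoC (INR q)) a
        + RtoC (digamma (INR q + 1)) * Phi lambda (- RtoC (INR q)) a)).
Proof.
  intros hl hl1 ha ht.
  set (V := Csum _ q - _).
  (* The most demanding value is the derivative at s = -q, which asks for 4 <= K - q. *)
  set (K := (q + 4)%nat).
  assert (HK : (INR K = INR q + 4)%R) by (unfold K; rewrite plus_INR; simpl; lra).
  pose proof (pos_INR q) as Hq.
  assert (hat : (0 < Re (a - t))%R).
  { pose proof (re_le_Cmod t). pose proof (Rle_abs (Re t)).
    replace (Re (a - t)) with (Re a - Re t)%R by reflexivity. lra. }
  set (b := fun m : nat => RtoC (INR m) + a).
  assert (Hb : forall m, (INR m + Re a <= Cmod (b m))%R).
  { intros m. eapply Rle_trans; [|apply re_le_Cmod].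
    eapply Rle_trans; [|apply Rle_abs]. right; reflexivity. }
  assert (Hb0 : forall m, b m <> 0).
  { intros m. apply Cmod_gt_0. specialize (Hb m). pose proof (pos_INR m). lra. }
  set (c := fun n => t ^ (n + S q) / RtoC (INR (n + S q))).
  set (f := fun n m => (/ b m) ^ S n * c n).
  (* The common value for fixed [m]: its regularized sum over [m] is [V] by the closed form, and its
     expansion in [n] leads to the left-hand side. *)
  set (U := fun m => (b m) ^ q * (Clog (b m) - Clog (b m - t)
              - psum (fun j => (t / b m) ^ S j / RtoC (INR (S j))) q)).
  assert (HU : abel_sum lambda K U V).
  { eapply abel_sum_ext.
    - intros m. apply (log_remainder_closed_form (b m) t q (Hb0 m)).
    - unfold V. rewrite (Cminus_alt (Csum _ q)).
      apply abel_sum_ext with (f := fun m =>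
        Csum (fun k => t ^ (q - k) * RtoC (Binomial.C q k) *
          (- Clog (RtoC (INR m) + (a - t)) * (RtoC (INR m) + (a - t)) ^ k
           + RtoC (digamma (INR k + 1)) * (RtoC (INR m) + (a - t)) ^ k)) q
        + - (1) * (- Clog (RtoC (INR m) + a) * (RtoC (INR m) + a) ^ q
                   + RtoC (digamma (INR q + 1)) * (RtoC (INR m) + a) ^ q)).
      { intros m. rewrite (Cminus_alt (Csum _ q)). f_equal.
        apply Csum_ext. intros k Hk.
        replace (RtoC (INR m) + (a - t)) with (b m - t) by (unfold b; ring). ring. }
      apply abel_sum_plus; [exact hl1 | | apply abel_sum_scal; [exact hl1|];
        apply abel_sum_plus; [exact hl1 | apply dPhi_opp_abel_sum; try assumption; lra |
          apply abel_sum_scal; [exact hl1|]; apply Phi_opp_abel_sum; try assumption; lra]].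
      rewrite (Csum_ext _ (fun k => t ^ (q - k) * RtoC (Binomial.C q k)
          * (dPhi lambda (- RtoC (INR k)) (a - t)
             + RtoC (digamma (INR k + 1)) * Phi lambda (- RtoC (INR k)) (a - t))))
        by (intros; ring).
      apply (abel_sum_Csum lambda hl1 K q (fun k m => t ^ (q - k) * RtoC (Binomial.C q k) *
          (- Clog (RtoC (INR m) + (a - t)) * (RtoC (INR m) + (a - t)) ^ k
           + RtoC (digamma (INR k + 1)) * (RtoC (INR m) + (a - t)) ^ k))).
      intros k Hk. assert (INR k <= INR q)%R by now apply le_INR.
      apply abel_sum_scal; [exact hl1|].
      apply abel_sum_plus; [exact hl1 | apply dPhi_opp_abel_sum; try assumption; lra |].
      apply abel_sum_scal; [exact hl1|]. apply Phi_opp_abel_sum; try assumption; lra. }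
  assert (Hf : forall n, abel_sum lambda K (f n) (Phi lambda (RtoC (INR n) + 1) a * c n)).
  { intros n. rewrite Cmult_comm. eapply abel_sum_ext;
      [|apply abel_sum_scal; [exact hl1|]; apply Phi_succ_abel_sum; try assumption; lra].
    intros m. unfold f. cbv beta. unfold b. ring. }
  assert (HfU : forall m, Cseries (fun n => f n m) (U m)).
  { intros m. apply log_remainder_series. unfold b, Re in *. simpl. pose proof (pos_INR m). lra. }
  (* [x] is the ratio of the geometric majorant in [n]; [T] is the power of |t| in the first of the
     terms with n >= 1. *)
  set (x := (Cmod t / Re a)%R).
  assert (Hx : (0 <= x < 1)%R).
  { pose proof (Cmod_ge_0 t). split; [apply Rdiv_le_0_compat; lra|].
    apply (Rdiv_lt_1 (Cmod t)); lra. }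
  set (T := (Cmod t ^ S (S q))%R).
  assert (HT : (0 <= T)%R) by apply pow_le, Cmod_ge_0.
  (* The term [n = 0] only decays like [1 / m]; it is split off because the
     others admit a crude bound that is summable in both [n] and [m]. *)
  destruct (abel_sum_exchange lambda hl K (fun n => f (S n))
    (fun m => (2 ^ K * T * / (INR m + Re a) ^ 2)%R) (fun n => (x ^ n)%R)
    (fun m => U m + - (1) * f 0%nat m)
    (fun n => Phi lambda (RtoC (INR (S n)) + 1) a * c (S n))) as [L [HL HL']].
  - intros n m.
    replace (2 ^ K * T * / (INR m + Re a) ^ 2 * x ^ n)%R with
      (2 ^ K * (T * x ^ n * / (INR m + Re a) ^ 2))%R by ring.
    apply (fdiffs_bound K (f (S n)) (fun m => (T * x ^ n * / (INR m + Re a) ^ 2)%R)).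
    + intros k. pose proof (pos_INR k). apply Rmult_le_compat_l.
      * apply Rmult_le_pos; [exact HT | apply pow_le, Hx].
      * rewrite S_INR. apply Rinv_le_contravar; [apply pow_lt; lra|].
        apply pow_incr. lra.
    + intros k. pose proof (pos_INR k) as Hk. specialize (Hb k).
      unfold f, c. rewrite Cmod_mult, Cmod_pow, Cmod_inv by apply Hb0.
      assert (Hinv1 : (/ Cmod (b k) <= / (INR k + Re a))%R)
        by (apply Rinv_le_contravar; lra).
      assert (Hinv2 : (/ (INR k + Re a) <= / Re a)%R)
        by (apply Rinv_le_contravar; lra).
      assert (Hi0 : (0 < / Cmod (b k))%R) by (apply Rinv_0_lt_compat; lra).
      (* Two factors 1 / |b k| are kept for summability over [k]; the other [n] are replaced by 1 /
         Re a and join |t|^n to form x^n. *)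
      assert (Hi1 : ((/ Cmod (b k)) ^ S (S n) <= (/ Re a) ^ n * / (INR k + Re a) ^ 2)%R).
      { replace (S (S n)) with (n + 2)%nat by lia. rewrite pow_add.
        rewrite <- pow_inv.
        apply Rmult_le_compat; [apply pow_le; lra | apply pow_le; lra | |];
          apply pow_incr; lra. }
      assert (Hnq : (1 <= INR (S n + S q))%R).
      { change 1%R with (INR 1). apply le_INR. lia. }
      assert (Hi2 : (Cmod (t ^ (S n + S q) / RtoC (INR (S n + S q))) <= T * Cmod t ^ n)%R).
      { rewrite Cmod_div, Cmod_pow, Cmod_R, Rabs_pos_eq by
          first [lra | intros E; apply RtoC_inj in E; lra].
        replace (T * Cmod t ^ n)%R with (Cmod t ^ (S n + S q) * 1)%R
          by (unfold T; rewrite <- pow_add, Rmult_1_r; f_equal; lia).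
        apply Rmult_le_compat_l; [apply pow_le, Cmod_ge_0|].
        rewrite <- Rinv_1. apply Rinv_le_contravar; lra. }
      replace (T * x ^ n * / (INR k + Re a) ^ 2)%R with
        (((/ Re a) ^ n * / (INR k + Re a) ^ 2) * (T * Cmod t ^ n))%R
        by (unfold x, Rdiv; rewrite Rpow_mult_distr; ring).
      apply Rmult_le_compat; [apply pow_le; lra | apply Cmod_ge_0 | exact Hi1 | exact Hi2].
  - apply (ex_series_scal_l (V := R_NormedModule) (2 ^ K * T)%R), ex_series_inv_sqr, ha.
  - apply ex_series_geom. rewrite Rabs_pos_eq; lra.
  - intros m. apply (Cseries_shift (fun n => f n m)).
    replace (f 0%nat m + (U m + - (1) * f 0%nat m)) with (U m) by ring. apply HfU.
  - intros n. apply Hf.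
  (* The term [n = 0] is put back; by linearity of regularized summation it was removed from [V] in
     [L]. *)
  - replace V with (Phi lambda (RtoC (INR 0) + 1) a * c 0%nat + L).
    + apply (Cseries_shift (fun n => Phi lambda (RtoC (INR n) + 1) a * c n)). exact HL.
    + rewrite (abel_sum_unique lambda K (fun m => U m + - (1) * f 0%nat m) L
        (V + - (1) * (Phi lambda (RtoC (INR 0) + 1) a * c 0%nat)) HL').
      * ring.
      * apply abel_sum_plus; [exact hl1 | exact HU | apply abel_sum_scal; [exact hl1 | apply Hf]].
Qed.

Theorem theorem3 (lambda a t : C) (p : nat)
  (hlambda : (Cmod lambda <= 1)%R) (hlambda1 : lambda <> RtoC 1)
  (ha : (0 < Re a)%R) (ht : (Cmod t < Re a)%R) (hp : (1 <= p)%nat) :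
  Cseries
    (fun n : nat =>
       Phi lambda (RtoC (INR n) + 1) a * (t ^ (n + p) / RtoC (INR (n + p))))
    (sum_n (G := C_AbelianMonoid)
       (fun k : nat =>
          RtoC (Binomial.C (p - 1) k)
          * (dPhi lambda (- RtoC (INR k)) (a - t)
             + RtoC (digamma (INR k + 1)) * Phi lambda (- RtoC (INR k)) (a - t))
          * t ^ (p - 1 - k))
       (p - 1)
     - (dPhi lambda (1 - RtoC (INR p)) a
        + RtoC (digamma (INR p)) * Phi lambda (1 - RtoC (INR p)) a)).
Proof.
  destruct p as [|q]; [lia|].
  replace (1 - RtoC (INR (S q))) with (- RtoC (INR q)) by (rewrite S_INR, RtoC_plus; ring).
  rewrite (S_INR q). replace (S q - 1)%nat with q by lia.
  now apply Phi_sum_digamma.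
Qed.
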